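(* Let $H\subset\mathbb{N}$ be a numerical semigroup minimally generated by $h_1,h_2,h_3$ with $\gcd(h_1,h_2,h_3)=1$, let $R=K[H]$, let $L\subset\mathbb{Z}^3$ be the relation lattice of $H$, and let $c_i$, $r_{ij}$, $v_1,v_2,v_3$ be as defined in the context. Then: (a) If $v_1+v_2+v_3=0$, then $\dim_KT^1(R)_{-h_i}=1$ and $L$ is $i$-separable for $i=1,2,3$. (b) If $v_1+v_2+v_3\ne0$, then there exists $i\in[3]$ such that $I_L=(x_i^{c_i}-x_k^{r_{ik}}x_\ell^{r_{i\ell}},\;x_k^{c_k}-x_\ell^{c_\ell})$ with $\{i,k,\ell\}=[3]$ and $r_{ik},r_{i\ell}\ne0$. In this case, $T^1(R)_{-h_i}=0$, and for each $j\in[3]$ with $j\ne i$ one has $T^1(R)_{-h_j}\ne0$ and $L$ is $j$-separable.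
   Context: $K$ is a field of characteristic $0$, $[3]=\{1,2,3\}$, $S=K[x_1,x_2,x_3]$, $R=K[H]=K[t^{h_1},t^{h_2},t^{h_3}]$. The relation lattice $L$ is the kernel of $\mathbb{Z}^3\to\mathbb{Z}$, $\epsilon_i\mapsto h_i$. For $i\in[3]$, with $\{i,k,\ell\}=[3]$, $c_i$ is the smallest positive integer with $c_ih_i\in\mathbb{N}h_k+\mathbb{N}h_\ell$, and $r_{ik},r_{i\ell}$ are nonnegative integers with $c_ih_i=r_{ik}h_k+r_{i\ell}h_\ell$. Put $v_1=(c_1,-r_{12},-r_{13})$, $v_2=(-r_{21},c_2,-r_{23})$, $v_3=(-r_{31},-r_{32},c_3)$. By a known structure theorem, these choices can be made, and are made, so that $v_1,v_2,v_3$ generate $L$ and (up to the numbering of the generators) one of the following holds: (1) all $r_{ij}\ne0$ and $v_1+v_2+v_3=0$; (2) $v_1=(c_1,-c_2,0)$, $v_2=(0,c_2,-c_3)$, $v_3=(-c_1,0,c_3)$; (3) $v_1+v_2+v_3\ne0$, and there are distinct $k,\ell\in[3]$ with $v_k+v_\ell=0$ and $r_{ij}\ne0$ for $i\in[3]\setminus\{k,\ell\}$ and $j\in\{k,\ell\}$. For $v\in\mathbb{Z}^n$ put $f_v=\prod_{v(i)\ge0}x_i^{v(i)}-\prod_{v(i)\le0}x_i^{-v(i)}$. For a lattice $L\subset\mathbb{Z}^n$, $I_L=(f_v:v\in L)$; $L$ is saturated if $\mathbb{Z}^n/L$ is torsionfree. Let $\pi_i:K[x_1,\ldots,x_{n+1}]\to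 K[x_1,\ldots,x_n]$ be the $K$-algebra map with $\pi_i(x_j)=x_j$ for $j\le n$, $\pi_i(x_{n+1})=x_i$. A saturated $L\subset\mathbb{Z}^n$ is $i$-separable if there is a saturated lattice $L'\subset\mathbb{Z}^{n+1}$ such that (i) $\operatorname{rank}L'=\operatorname{rank}L$; (ii) $\pi_i(I_{L'})=I_L$; (iii) there is a minimal system of generators $f_{w_1},\ldots,f_{w_s}$ of $I_{L'}$ such that $(w_1(n+1),\ldots,w_s(n+1))$ and $(w_1(i),\ldots,w_s(i))$ are linearly independent. Definition of $T^1$: for $v\in L$ put $h(v)=\sum_{v(i)\ge0}v(i)h_i$. Let $\bigoplus_iR\,dx_i$ be the free graded $R$-module with $\deg dx_i=h_i$, and $U$ its submodule generated by $df_v=\sum_iv(i)t^{h(v)-h_i}dx_i$, $v\in L$. With $M^*=\operatorname{Hom}_R(M,R)$, $T^1(R)$ is the cokernel of the restriction map $(\bigoplus_iR\,dx_i)^*\to U^*$; it is $\mathbb{Z}$-graded (here $\mathbb{Z}H=\mathbb{Z}$) and isomorphic to $\operatorname{Ext}^1_R(\Omega_{R/K},R)$. *)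

(* Defs.v *)
From HB Require Import structures.
From mathcomp Require Import all_boot all_order all_algebra.
From mathcomp Require Import boolp.
From mathcomp Require Import mpoly.

Set Implicit Arguments.
Unset Strict Implicit.
Unset Printing Implicit Defensive.

Import Order.TTheory GRing.Theory Num.Theory.
Local Open Scope ring_scope.

(* Submodules and ideals generated by a family, as Prop-valued sets. *)

Definition span_of (R : comNzRingType) (V : lmodType R) (A : V -> Prop)
    (u : V) : Prop :=
  exists (m : nat) (a : 'I_m -> R) (g : 'I_m -> V),
    (forall j, A (g j)) /\ u = \sum_(j < m) a j *: g j.

Definition ideal_of (S : comNzRingType) (A : S -> Prop) : S -> Prop :=
  @span_of S S^o A.

Definition same_set (T : Type) (A B : T -> Prop) : Prop := forall x, A x <-> B x.

Definition minimal_generators (S : comNzRingType) (I : S -> Prop) (s : nat)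
    (f : 'I_s -> S) : Prop :=
  same_set (ideal_of (fun p => exists j, p = f j)) I /\
  forall j, ~ same_set (ideal_of (fun p => exists2 k, k != j & p = f k)) I.

(* Lattices in Z^n, as decidable sets of row vectors. *)

Definition saturated n (L : {pred 'rV[int]_n}) : Prop :=
  forall (m : int) (v : 'rV[int]_n), m != 0 -> m *: v \in L -> v \in L.

(* The rows of [B] form a Z-basis of [L]. *)
Definition lattice_rank n (L : {pred 'rV[int]_n}) (r : nat) : Prop :=
  exists B : 'M[int]_(r, n),
    row_free (map_mx (intr : int -> rat) B) /\
    forall v, v \in L <-> exists a : 'rV[int]_r, v = a *m B.

Definition binomial_of (K : fieldType) n (v : 'rV[int]_n) : {mpoly K[n]} :=
  \prod_(i < n | 0 <= v 0 i) 'X_i ^+ `|v 0%R i|%N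
  - \prod_(i < n | v 0 i <= 0) 'X_i ^+ `|v 0%R i|%N.

Definition lattice_ideal (K : fieldType) n (L : {pred 'rV[int]_n}) :
    {mpoly K[n]} -> Prop :=
  ideal_of (fun p => exists2 v, v \in L & p = binomial_of K v).

(* The new, (n+1)-st, coordinate is the one of index [ord_max]; the index
   [j : 'I_n] becomes [widen_ord (leqnSn n) j] in 'I_n.+1. *)
Definition pi_map (K : fieldType) n (i : 'I_n) (p : {mpoly K[n.+1]}) :
    {mpoly K[n]} :=
  comp_mpoly [tuple (if unlift ord_max j is Some j' then 'X_j' else 'X_i)
             | j < n.+1] p.

Definition separable_at (K : fieldType) n (L : {pred 'rV[int]_n}) (i : 'I_n) :
    Prop :=
  [/\ zmod_closed L, saturated L &
    exists L' : {pred 'rV[int]_n.+1},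
    [/\ zmod_closed L' /\ saturated L',
        exists r, lattice_rank L' r /\ lattice_rank L r,
        same_set
          (fun q => exists2 p, lattice_ideal (K := K) L' p & q = pi_map i p)
          (lattice_ideal (K := K) L) &
        exists (s : nat) (w : 'I_s -> 'rV[int]_n.+1),
        [/\ forall j, w j \in L',
            minimal_generators (lattice_ideal (K := K) L')
              (fun j => binomial_of K (w j)) &
            free [:: \row_(j < s) ((w j 0 ord_max)%:~R : rat);
                     \row_(j < s) ((w j 0 (widen_ord (leqnSn n) i))%:~R : rat)]]]].

(* [in_semigroup h P m]: [m] lies in the submonoid of N generated by the [h j]
   with [P j].  Bounding the coefficients by [m] loses nothing: a coefficient
   larger than [m] can only occur in front of [h j = 0]. *)
Definition in_semigroup n (h : 'I_n -> nat) (P : pred 'I_n) (m : nat) : bool :=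
  [exists a : {ffun 'I_n -> 'I_m.+1}, m == (\sum_(j < n | P j) a j * h j)%N].

Definition relation_lattice n (h : 'I_n -> nat) : {pred 'rV[int]_n} :=
  [pred v : 'rV[int]_n | \sum_(i < n) v 0 i * (h i)%:Z == 0].

Lemma in_semigroupP n (h : 'I_n -> nat) (P : pred 'I_n) m :
  reflect (exists a : 'I_n -> nat, m = (\sum_(j < n | P j) a j * h j)%N)
          (in_semigroup h P m).
Proof.
apply: (iffP existsP) => [[a /eqP ->]|[a Ea]]; first by exists (fun j => a j : nat).
exists [ffun j => inord (if h j == 0%N then 0%N else a j)]; apply/eqP.
rewrite {1}Ea; apply: eq_bigr => j Pj; rewrite ffunE.
case: eqP => [->|/eqP hj]; first by rewrite !muln0.
rewrite inordK // ltnS Ea (bigD1 j) //=.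
by apply: leq_trans (leq_addr _ _); rewrite leq_pmulr // lt0n.
Qed.

(* The semigroup ring K[H], as the K-subalgebra of K[t] of the polynomials
   whose exponents all lie in H. *)

Section SemigroupRing.
Variables (K : fieldType) (n : nat) (h : 'I_n -> nat).

Definition semigroup_poly : {pred {poly K}} :=
  [pred p : {poly K} |
    [forall m : 'I_(size p), (p`_m != 0) ==> in_semigroup h predT m]].

Lemma semigroup_polyP (p : {poly K}) :
  reflect (forall m, p`_m != 0 -> in_semigroup h predT m)
          (p \in semigroup_poly).
Proof.
apply: (iffP forallP) => [Hp m pm|Hp m]; last by apply/implyP; apply: Hp.
have lt_m : (m < size p)%N.
  by rewrite ltnNge; apply: contra pm => ?; rewrite nth_default.
by have /implyP := Hp (Ordinal lt_m); apply.
Qed.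

Lemma semigroup_poly_closed : subalg_closed semigroup_poly.
Proof.
split=> [|a p q /semigroup_polyP Hp /semigroup_polyP Hq
        |p q /semigroup_polyP Hp /semigroup_polyP Hq]; apply/semigroup_polyP.
- move=> m; rewrite coef1; case: m => [_|m]; last by rewrite eqxx.
  by apply/in_semigroupP; exists (fun=> 0%N); rewrite big1.
- move=> m; rewrite coefD coefZ => nz.
  have [q0|/Hq //] := eqVneq q`_m 0; apply: Hp; apply: contra nz => /eqP ->.
  by rewrite q0 mulr0 addr0.
move=> m; rewrite coefM => nz.
have /existsP[j /andP[pj qj]] :
    [exists j : 'I_m.+1, (p`_j != 0) && (q`_(m - j) != 0)].
  apply: contraNT nz => /existsPn nz; apply/eqP; apply: big1 => j _.
  by have := nz j; rewrite negb_and !negbK => /orP[]/eqP ->; rewrite ?mul0r ?mulr0.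
have /in_semigroupP[a Ea] := Hp _ pj; have /in_semigroupP[b Eb] := Hq _ qj.
apply/in_semigroupP; exists (fun i => (a i + b i)%N).
rewrite -(subnKC (ltnSE (ltn_ord j))) [X in (X + _)%N]Ea [X in (_ + X)%N]Eb.
by rewrite -big_split; apply: eq_bigr => i _; rewrite mulnDl.
Qed.

HB.instance Definition _ :=
  GRing.isSubalgClosed.Build K {poly K} semigroup_poly semigroup_poly_closed.

Record semigroup_ring := SemigroupRing {
  sr_poly :> {poly K};
  sr_polyP : sr_poly \in semigroup_poly }.

HB.instance Definition _ := [isSub for sr_poly].
HB.instance Definition _ := [Choice of semigroup_ring by <:].
HB.instance Definition _ := [SubChoice_isSubAlgebra of semigroup_ring by <:].
HB.instance Definition _ :=
  [SubNzRing_isSubComNzRing of semigroup_ring by <:].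

End SemigroupRing.

Section TangentModule.
Variables (K : fieldType) (n : nat) (h : 'I_n -> nat).
Local Notation R := (semigroup_ring K h).

(* t ^ m, for m in H; the value outside H is irrelevant (see [differential]). *)
Definition tpow (m : nat) : R := insubd (0 : R) ('X^m : {poly K}).

Definition vdegree (v : 'rV[int]_n) : nat :=
  (\sum_(i < n | (0 <= v 0%R i)%R) `|v 0%R i| * h i)%N.

(* The element d f_v of the free module on dx_1, ..., dx_n.  If v is in the
   relation lattice and v(i) <> 0, then h(v) - h_i is a nonnegative element of
   H; if v(i) = 0, the i-th coordinate is 0. *)
Definition differential (v : 'rV[int]_n) : 'rV[R]_n :=
  \row_(i < n) ((v 0 i)%:~R * tpow (vdegree v - h i)).

Definition in_Umod : {pred 'rV[R]_n} :=
  [pred u : 'rV[R]_n |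
    `[< span_of (fun g => exists2 v, v \in relation_lattice h
                                   & g = differential v) u >]].

Lemma in_Umod_closed : submod_closed in_Umod.
Proof.
split=> [|a u w /asboolP[m [b [g [Hg ->]]]] /asboolP[m' [b' [g' [Hg' ->]]]]].
  apply/asboolP; exists 0%N, (fun=> 0), (fun=> 0); split; first by case.
  by rewrite big_ord0.
apply/asboolP; exists (m + m')%N,
  (fun j => match split j with inl k => a * b k | inr k => b' k end),
  (fun j => match split j with inl k => g k | inr k => g' k end).
split=> [j|]; first by case: (split j).
rewrite big_split_ord /= scaler_sumr; congr (_ + _).
  apply: eq_bigr => k _.
  by rewrite (unsplitK (inl _ k : 'I_m + 'I_m')%type) scalerA.
apply: eq_bigr => k _.
by rewrite (unsplitK (inr _ k : 'I_m + 'I_m')%type).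
Qed.

HB.instance Definition _ :=
  GRing.isSubmodClosed.Build R 'rV[R]_n in_Umod in_Umod_closed.

Record Umod := UMod { Uval :> 'rV[R]_n; UvalP : Uval \in in_Umod }.

HB.instance Definition _ := [isSub for Uval].
HB.instance Definition _ := [Choice of Umod by <:].
HB.instance Definition _ := [SubChoice_isSubLmodule of Umod by <:].

(* 0 is homogeneous of every degree. *)
Definition homogR (b : int) (p : R) : Prop :=
  forall m : nat, (p : {poly K})`_m != 0 -> m%:Z = b.

Definition homogU (b : int) (u : Umod) : Prop :=
  forall i : 'I_n, homogR (b - (h i)%:Z) (Uval u 0 i).

(* The homogeneous elements of degree [a] of U^* = Hom_R(U, R). *)
Definition homogU_dual (a : int) (phi : {linear Umod -> R^o}) : Prop :=
  forall (b : int) (u : Umod), homogU b u -> homogR (a + b) (phi u).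

(* [phi] has class 0 in T^1(R): it lies in the image of the restriction map
   from the dual of the free module. *)
Definition T1_class_zero (phi : Umod -> R) : Prop :=
  exists psi : {linear 'rV[R]_n -> R^o}, forall u : Umod, phi u = psi (Uval u).

Definition T1_degree_zero (a : int) : Prop :=
  forall phi : {linear Umod -> R^o}, homogU_dual a phi -> T1_class_zero phi.

(* dim_K T^1(R)_a = d: the classes of some [d] homogeneous elements of degree
   [a] of U^* form a K-basis of the component of degree [a] of T^1(R). *)
Definition T1_degree_dim (a : int) (d : nat) : Prop :=
  exists e : 'I_d -> {linear Umod -> R^o},
    (forall j, homogU_dual a (e j)) /\
    forall phi : {linear Umod -> R^o}, homogU_dual a phi ->
      exists! x : 'rV[K]_d,
        T1_class_zero (fun u => phi u - \sum_(j < d) x 0 j *: (e j u : R)).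

End TangentModule.

(* The row vectors v_1, v_2, v_3 are the rows i of [relmx c r]; the diagonal of
   [r] is not used. *)
Definition relmx n (c : 'I_n -> nat) (r : 'I_n -> 'I_n -> nat) : 'M[int]_n :=
  \matrix_(i, j) (if j == i then (c i)%:Z else - (r i j)%:Z).

Definition smallest_multiple n (h : 'I_n -> nat) (i : 'I_n) (c : nat) : Prop :=
  [/\ (0 < c)%N, in_semigroup h (predC1 i) (c * h i) &
      forall c', (0 < c')%N -> in_semigroup h (predC1 i) (c' * h i) ->
                 (c <= c')%N].

(* The three cases of the structure theorem, up to renumbering of the h_i. *)
Definition structure_cases (c : 'I_3 -> nat) (r : 'I_3 -> 'I_3 -> nat) : Prop :=
  let v i := row i (relmx c r) in
  let e i := delta_mx 0 i : 'rV[int]_3 in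
  [\/ (forall i j, i != j -> r i j != 0%N) /\ \sum_i v i = 0,
      exists i k l : 'I_3,
        [/\ uniq [:: i; k; l],
            v i = (c i)%:Z *: e i - (c k)%:Z *: e k,
            v k = (c k)%:Z *: e k - (c l)%:Z *: e l &
            v l = (c l)%:Z *: e l - (c i)%:Z *: e i] |
      \sum_i v i != 0 /\
      exists k l : 'I_3,
        [/\ k != l, v k + v l = 0 &
            forall i j, i \notin [:: k; l] -> j \in [:: k; l] ->
                        r i j != 0%N]].

(* With {i, k, l} = [3]: I_L = (x_i^c_i - x_k^r_ik x_l^r_il, x_k^c_k - x_l^c_l)
   and r_ik, r_il <> 0. *)
Definition complete_intersection_form (K : fieldType) (h : 'I_3 -> nat)
    (c : 'I_3 -> nat) (r : 'I_3 -> 'I_3 -> nat) (i k l : 'I_3) : Prop :=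
  [/\ uniq [:: i; k; l],
      same_set (lattice_ideal (K := K) (relation_lattice h))
        (ideal_of (fun p : {mpoly K[3]} =>
           p = 'X_i ^+ c i - 'X_k ^+ r i k * 'X_l ^+ r i l \/
           p = 'X_k ^+ c k - 'X_l ^+ c l)),
      r i k != 0%N & r i l != 0%N].

(* Main.v *)
(* A homogeneous element phi of U^* of degree -h_i is given by an additive map
   lambda : L -> K with phi (d f_v) = lambda(v) t^(h(v) - h_i), subject to
   lambda(v) = 0 whenever h(v) - h_i is not in H.  Since h_j - h_i is not in H for
   j <> i, phi vanishes in T^1 iff lambda is a multiple of v |-> v(i).  The lattice L
   has rank 2, and h(v) - h_i can only lie outside H if v(i) = 0.  So T^1 in degree
   -h_i has dimension 1 if h(v) - h_i is in H for every nonzero v in L, and it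
   vanishes otherwise; which case occurs is read off from the r_ki and the
   minimality of the c_k.

   For the separations, the binomial of any a - b in the lattice is in the ideal J
   generated by the proposed binomials as soon as a and b are connected inside the
   orthant by moves along the proposed vectors; the sign patterns of the v_i make
   this possible, both in Z^3 and after splitting the i-th coordinate into two.
   Minimality of the generators is checked by evaluation at points with coordinates
   0 and 1. *)
From HB Require Import structures.
Require Import Defs.
From mathcomp Require Import all_boot all_order all_algebra.
From mathcomp Require Import boolp mpoly zify ring.

Set Implicit Arguments.
Unset Strict Implicit.
Unset Printing Implicit Defensive.

Import Order.TTheory GRing.Theory Num.Theory.
Local Open Scope ring_scope.

(** * Enumerations of the three indices *)

Lemma ord3_cover (i k l j : 'I_3) :
  uniq [:: i; k; l] -> [|| j == i, j == k | j == l].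
Proof.
rewrite /= !inE -!val_eqE /=.
by move: (ltn_ord i) (ltn_ord k) (ltn_ord l) (ltn_ord j); lia.
Qed.

Lemma big_ord3 (T : Type) (idx : T) (op : Monoid.com_law idx) (i k l : 'I_3)
    (F : 'I_3 -> T) : uniq [:: i; k; l] ->
  \big[op/idx]_j F j = op (F i) (op (F k) (F l)).
Proof.
move=> ikl; have := ikl; rewrite /= !inE negb_or andbT => /andP[/andP[ik il] kl].
rewrite (bigD1 i) // (bigD1 k) 1?eq_sym // (bigD1 l) ?big1 ?Monoid.mulm1 //.
  move=> j /andP[/andP[/negPf ji /negPf jk] /negPf jl].
  by have := ord3_cover j ikl; rewrite ji jk jl.
by rewrite ![l == _]eq_sym il.
Qed.

Lemma big_ord3_neq (T : Type) (idx : T) (op : Monoid.com_law idx) (i k l : 'I_3)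
    (F : 'I_3 -> T) : uniq [:: i; k; l] ->
  \big[op/idx]_(j < 3 | j != i) F j = op (F k) (F l).
Proof.
move=> ikl; have := ikl; rewrite /= !inE negb_or andbT => /andP[/andP[ik il] kl].
rewrite big_mkcond (big_ord3 _ _ ikl) eqxx /= Monoid.mul1m.
by rewrite ![_ == i]eq_sym ik il.
Qed.

Lemma uniq3_perm (i k l : 'I_3) : uniq [:: i; k; l] ->
  [/\ uniq [:: i; l; k], uniq [:: k; i; l], uniq [:: k; l; i],
     uniq [:: l; i; k] & uniq [:: l; k; i]].
Proof.
rewrite /= !inE !negb_or !andbT => /andP[/andP[ik il] kl].
by rewrite ![k == i]eq_sym ![l == _]eq_sym ik il kl.
Qed.

Lemma uniq3_neq (i k l : 'I_3) : uniq [:: i; k; l] ->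
  [/\ (k == i) = false, (i == k) = false, (l == i) = false,
     (i == l) = false & (k == l) = false] /\ (l == k) = false.
Proof.
rewrite /= !inE !negb_or !andbT => /andP[/andP[ik il] kl].
by rewrite ![k == i]eq_sym ![l == _]eq_sym (negPf ik) (negPf il) (negPf kl).
Qed.

Lemma ord3_others (i : 'I_3) : exists k l, uniq [:: i; k; l].
Proof.
exists (ordS i), (ordS (ordS i)); rewrite /= !inE -!val_eqE /=.
by case: i => [[|[|[|]]]].
Qed.

Lemma ord3_third (k l : 'I_3) : k != l -> exists i, uniq [:: i; k; l].
Proof.
move=> kl; have [a [b kab]] := ord3_others k.
have [kba akb _ bka _] := uniq3_perm kab.
have /or3P[/eqP El|/eqP ->|/eqP ->] := ord3_cover l kab; last by exists a.
  by rewrite El eqxx in kl.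
by exists b.
Qed.

(** * The homogeneous components of the dual of U *)

Section Semigroup.
Variables (n : nat) (h : 'I_n -> nat).

Lemma in_semigroup0 P : in_semigroup h P 0.
Proof. by apply/in_semigroupP; exists (fun=> 0%N); rewrite big1. Qed.

Lemma in_semigroupD P a b :
  in_semigroup h P a -> in_semigroup h P b -> in_semigroup h P (a + b).
Proof.
move=> /in_semigroupP[x ->] /in_semigroupP[y ->]; apply/in_semigroupP.
exists (fun j => x j + y j)%N; rewrite -big_split.
by apply: eq_bigr => j _; rewrite mulnDl.
Qed.

Lemma in_semigroup_gen (P : pred 'I_n) j : P j -> in_semigroup h P (h j).
Proof.
move=> Pj; apply/in_semigroupP; exists (fun k => (k == j) : nat).
rewrite (bigD1 j) //= eqxx mul1n big1 ?addn0 // => k /andP[_ /negPf ->].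
by rewrite mul0n.
Qed.

Lemma in_semigroupM (P : pred 'I_n) m a :
  in_semigroup h P a -> in_semigroup h P (m * a).
Proof.
move=> Ha; elim: m => [|m IH]; first by rewrite mul0n in_semigroup0.
by rewrite mulSn in_semigroupD.
Qed.

Lemma generator_gt0 i : ~~ in_semigroup h (predC1 i) (h i) -> (0 < h i)%N.
Proof. by rewrite lt0n; apply: contraNneq => ->; apply: in_semigroup0. Qed.

(** If v(i) > 0, the i-th summand of h(v) contributes a copy of h_i. If v(i) < 0, the same applies
    to -v, and h(-v) = h(v) because v is a relation. *)
Lemma vdegree_relation (v : 'rV[int]_n) (i : 'I_n) :
  v \in relation_lattice h -> v 0 i != 0 ->
  exists2 m, in_semigroup h predT m & vdegree h v = (m + h i)%N.
Proof.
have pos (w : 'rV[int]_n) : 0 < w 0 i ->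
    exists2 m, in_semigroup h predT m & vdegree h w = (m + h i)%N.
  move=> wi; rewrite /vdegree (bigD1 i) ?ltW //= addnC.
  exists (\sum_(j < n | (0 <= w 0 j)%R && (j != i)) `|w 0%R j| * h j
          + `|w 0%R i|.-1 * h i)%N.
    rewrite in_semigroupD ?in_semigroupM ?in_semigroup_gen //.
    apply: (big_ind (in_semigroup h predT)) => [||j _]; rewrite ?in_semigroup0 //.
      exact: in_semigroupD.
    by rewrite in_semigroupM ?in_semigroup_gen.
  rewrite -addnA; congr addn; rewrite addnC -mulSn prednK //; lia.
rewrite inE => /eqP vL; rewrite neq_lt => /orP[vi|]; last exact: pos.
have [|m Hm Em] := pos (- v); first by rewrite mxE oppr_gt0.
exists m => //; rewrite -Em /vdegree; apply/eqP; rewrite -(eqr_nat int).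
rewrite !natr_sum -subr_eq0 -[X in _ == X]vL big_mkcond.
rewrite [X in _ - X]big_mkcond /= -sumrB; apply/eqP/eq_bigr => j _.
rewrite !mxE; move: (v 0 j) => x; case: ifP; case: ifP; lia.
Qed.

End Semigroup.

(** * Computations in the semigroup ring and in U, carried out inside K[t] *)

Section SemigroupRingTheory.
Variables (K : fieldType) (n : nat) (h : 'I_n -> nat).
Hypothesis charK : [pchar K] =i pred0.
Local Notation R := (semigroup_ring K h).
Local Notation L := (relation_lattice h).
Local Notation pol r := (sr_poly (r : R)).

Lemma intr_eq0_char0 (m : int) : (m%:~R == 0 :> K) = (m == 0).
Proof.
have /GRing.pcharf0P nat0 := charK.
by case: m => k; rewrite ?NegzE ?mulrNz ?oppr_eq0 -pmulrn nat0.
Qed.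

Lemma tpowE m : in_semigroup h predT m -> pol (tpow K h m) = 'X^m.
Proof.
move=> Hm; rewrite /tpow val_insubd ifT //; apply/semigroup_polyP => k.
by rewrite coefXn; have [->|_] := eqVneq k m; rewrite ?eqxx.
Qed.

Lemma sr_polyM (a b : R) : pol (a * b) = pol a * pol b.
Proof. exact: rmorphM (val : R -> {poly K}) _ _. Qed.

Lemma sr_polyD (a b : R) : pol (a + b) = pol a + pol b.
Proof. exact: raddfD (val : R -> {poly K}) _ _. Qed.

Lemma sr_polyZ (c : K) (a : R) : pol (c *: a) = c *: pol a.
Proof. exact: linearZZ (val : R -> {poly K}) _ _. Qed.

Lemma UvalD (u w : Umod K h) : Uval (u + w) = Uval u + Uval w.
Proof. exact: raddfD (val : Umod K h -> 'rV[R]_n) _ _. Qed.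

Lemma UvalZ (a : R) (u : Umod K h) : Uval (a *: u) = a *: Uval u.
Proof. exact: linearZZ (val : Umod K h -> 'rV[R]_n) _ _. Qed.

Definition Ucoord (u : Umod K h) j : {poly K} := pol (Uval u 0 j).

Lemma UcoordD (u w : Umod K h) j : Ucoord (u + w) j = Ucoord u j + Ucoord w j.
Proof. by rewrite /Ucoord UvalD mxE; apply: sr_polyD. Qed.

Lemma UcoordZ (a : R) (u : Umod K h) j : Ucoord (a *: u) j = pol a * Ucoord u j.
Proof. by rewrite /Ucoord UvalZ mxE; apply: sr_polyM. Qed.

Lemma sr_poly_inj (a b : R) : pol a = pol b -> a = b.
Proof. exact: val_inj. Qed.

Lemma Uval_inj (u w : Umod K h) : Uval u = Uval w -> u = w.
Proof. exact: val_inj. Qed.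

Lemma Ucoord_inj (u w : Umod K h) : Ucoord u =1 Ucoord w -> u = w.
Proof. by move=> E; apply/Uval_inj/rowP => j; apply/sr_poly_inj/E. Qed.

(** Division by t^(h_i) is replaced below by multiplication with a power of X and cancellation, so
    that negative exponents do not occur. *)
Lemma mulXnI m : injective (fun p : {poly K} => 'X^m * p).
Proof. by move=> p q; apply: mulfI; rewrite expf_neq0 ?polyX_eq0. Qed.

(** The factor X^e turns the integer degree d - e into the natural degree d, where homogeneity
    leaves a single monomial. *)
Lemma homogR_coef d e (a : R) :
  homogR (d%:Z - e%:Z) a -> 'X^e * pol a = ('X^e * pol a)`_d *: 'X^d.
Proof.
move=> Ha; apply/polyP => m; rewrite coefZ coefXn.
have [->|ne_md] := eqVneq m d; first by rewrite mulr1.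
rewrite mulr0 coefXnM; case: ltnP => // le_em.
by apply/eqP; apply: contraNT ne_md => /Ha; lia.
Qed.

(** The factor X^(h_j) undoes the truncated subtraction h(v) - h_j: the subtraction is exact if v(j)
    <> 0, and both sides vanish if v(j) = 0. *)
Lemma differentialE (v : 'rV[int]_n) j : v \in L ->
  'X^(h j) * pol (differential K h v 0 j) = (v 0 j)%:~R *: 'X^(vdegree h v).
Proof.
move=> vL; rewrite mxE sr_polyM.
have -> : pol (v 0 j)%:~R = ((v 0 j)%:~R : K)%:P.
  by rewrite rmorph_int; apply: (rmorph_int (val : R -> {poly K})).
rewrite mulrCA mul_polyC; have [->|nz] := eqVneq (v 0 j) 0.
  by rewrite !scale0r.
by have [m Hm ->] := vdegree_relation vL nz; rewrite addnK tpowE // -exprD addnC.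
Qed.

Definition Udifferential (v : 'rV[int]_n) : Umod K h :=
  insubd (0 : Umod K h) (differential K h v).
Local Notation dU := Udifferential.

Lemma UdifferentialE (v : 'rV[int]_n) : v \in L -> Uval (dU v) = differential K h v.
Proof.
move=> vL; rewrite /dU val_insubd ifT //; apply/asboolP.
exists 1%N, (fun=> 1), (fun=> differential K h v).
by split=> [_|]; [exists v | rewrite big_ord1 scale1r].
Qed.

Lemma Ucoord_differential (v : 'rV[int]_n) j : v \in L ->
  'X^(h j) * Ucoord (dU v) j = (v 0 j)%:~R *: 'X^(vdegree h v).
Proof. by move=> vL; rewrite /Ucoord UdifferentialE // differentialE. Qed.

Lemma Umod_ind (P : Umod K h -> Prop) :
  P 0 -> (forall a v u, v \in L -> P u -> P (a *: dU v + u)) -> forall u, P u.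
Proof.
move=> P0 Padd u; have /asboolP[m [a [g [Hg Eu]]]] := UvalP u.
have {Hg}/choice[v Hv] : forall j, exists v, v \in L /\ g j = differential K h v.
  by move=> j; have [v] := Hg j; exists v.
suff -> : u = \sum_(j < m) a j *: dU (v j).
  have {g Eu} {}Hv j : v j \in L by case: (Hv j).
  elim: m a v Hv => [|m IH] a v Hv; first by rewrite big_ord0.
  by rewrite big_ord_recl; apply: Padd (Hv _) (IH _ _ _) => j; apply: Hv.
apply: val_inj; rewrite raddf_sum /= Eu; apply: eq_bigr => j _.
by rewrite UdifferentialE ?(Hv j).1 ?(Hv j).2.
Qed.

End SemigroupRingTheory.

(** * The scalars attached to a homogeneous functional on U *)

Section Functional.
Variables (K : fieldType) (n : nat) (h : 'I_n -> nat).
Local Notation R := (semigroup_ring K h).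
Local Notation L := (relation_lattice h).
Local Notation pol r := (sr_poly (r : R)).
Local Notation dU := (Udifferential K h).

Lemma relation_latticeB (v w : 'rV[int]_n) : v \in L -> w \in L -> v - w \in L.
Proof.
rewrite !inE => v0 w0; under eq_bigr do rewrite !mxE mulrBl.
by rewrite sumrB (eqP v0) (eqP w0) subr0.
Qed.

Lemma relation_lattice0 : 0 \in L.
Proof. by rewrite inE big1 // => j _; rewrite mxE mul0r. Qed.

Lemma relation_lattice_closed : zmod_closed L.
Proof. by split; [apply: relation_lattice0 | apply: relation_latticeB]. Qed.

Lemma relation_latticeN (v : 'rV[int]_n) : v \in L -> - v \in L.
Proof. by move=> vL; rewrite -sub0r relation_latticeB ?relation_lattice0. Qed.

Lemma relation_latticeD (v w : 'rV[int]_n) : v \in L -> w \in L -> v + w \in L.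
Proof. by move=> vL wL; rewrite -[w]opprK relation_latticeB ?relation_latticeN. Qed.

Lemma in_semigroup_vdegree (v : 'rV[int]_n) : in_semigroup h predT (vdegree h v).
Proof.
rewrite /vdegree; apply: (big_ind (in_semigroup h predT)) => [||j _].
- exact: in_semigroup0.
- exact: in_semigroupD.
by rewrite in_semigroupM ?in_semigroup_gen.
Qed.

Lemma Udifferential_homog (v : 'rV[int]_n) : v \in L ->
  homogU (vdegree h v) (dU v).
Proof.
move=> vL j m; rewrite UdifferentialE // => nz.
have /(congr1 (fun p : {poly K} => p`_(m + h j))) := differentialE K j vL.
rewrite coefXnM ltnNge leq_addl /= addnK coefZ coefXn.
by case: eqP => [|_ E]; [lia | rewrite E mulr0 eqxx in nz].
Qed.

(* The scalar lambda(v) such that phi (d f_v) = lambda(v) t^(h(v) - h_i). *)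
Definition dual_coef (i : 'I_n) (phi : Umod K h -> R) (v : 'rV[int]_n) : K :=
  ('X^(h i) * pol (phi (dU v)))`_(vdegree h v).

Lemma dualD (phi : {linear Umod K h -> R^o}) (u w : Umod K h) :
  pol (phi (u + w)) = pol (phi u) + pol (phi w).
Proof. by rewrite linearD; apply: sr_polyD. Qed.

Lemma dualZ (phi : {linear Umod K h -> R^o}) (a : R) (u : Umod K h) :
  pol (phi (a *: u)) = pol a * pol (phi u).
Proof. by rewrite linearZ; apply: sr_polyM. Qed.

Variables (i : 'I_n) (phi : {linear Umod K h -> (semigroup_ring K h)^o}).
Hypothesis Hphi : homogU_dual (- (h i)%:Z) phi.

Lemma dual_coefE (v : 'rV[int]_n) : v \in L ->
  'X^(h i) * pol (phi (dU v)) = dual_coef i phi v *: 'X^(vdegree h v).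
Proof.
move=> vL; apply: homogR_coef; have := Hphi (Udifferential_homog vL).
by rewrite addrC.
Qed.

(** Since h(v + w) can differ from h(v) + h(w), the three differentials are first multiplied by
    powers of t that bring them to the common degree h(v) + h(w) + h(v + w). There they satisfy an
    additive relation in U, to which phi is applied. *)
Lemma dual_coefD (v w : 'rV[int]_n) : v \in L -> w \in L ->
  dual_coef i phi (v + w) = dual_coef i phi v + dual_coef i phi w.
Proof.
move=> vL wL; have vwL := relation_latticeD vL wL.
pose hv := vdegree h v; pose hw := vdegree h w; pose hs := vdegree h (v + w).
have tE a b : pol (tpow K h (vdegree h a + vdegree h b)) = 'X^(vdegree h a + vdegree h b).
  by rewrite tpowE // in_semigroupD ?in_semigroup_vdegree.
have rel : tpow K h (hv + hw) *: dU (v + w) =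
    tpow K h (hs + hw) *: dU v + tpow K h (hs + hv) *: dU w.
  apply: Ucoord_inj => j; apply: (@mulXnI K (h j)) => /=.
  rewrite UcoordD !UcoordZ mulrDr !(mulrCA 'X^(h j)) !Ucoord_differential //.
  rewrite !tE mxE intrD scalerDl mulrDr -!scalerAr -!exprD.
  congr (_ *: 'X^_ + _ *: 'X^_); rewrite /hv /hw /hs; lia.
have := congr1 (fun u => 'X^(h i) * pol (phi u)) rel.
rewrite dualD !dualZ mulrDr !(mulrCA 'X^(h i)).
rewrite !dual_coefE // !tE -!scalerAr -!exprD.
have -> : (hv + hw + vdegree h (v + w) = hs + hw + vdegree h v)%N by rewrite /hs; lia.
have -> : (hs + hv + vdegree h w = hs + hw + vdegree h v)%N by rewrite /hv; lia.
rewrite -scalerDl => /(congr1 (fun p : {poly K} => p`_(hs + hw + vdegree h v))).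
by rewrite !coefZ coefXn eqxx !mulr1.
Qed.

Lemma dual_coefMz (m : int) (v : 'rV[int]_n) : v \in L ->
  dual_coef i phi (m *: v) = m%:~R * dual_coef i phi v.
Proof.
move=> vL; have L0 := relation_lattice0.
have D0 : dual_coef i phi 0 = 0.
  by apply: (addrI (dual_coef i phi 0)); rewrite -dual_coefD // !addr0.
have nat_case k : k%:Z *: v \in L /\ dual_coef i phi (k%:Z *: v) = k%:R * dual_coef i phi v.
  elim: k => [|k [kL IH]]; first by rewrite scale0r mul0r.
  have -> : k.+1%:Z = k%:Z + 1 by lia.
  by rewrite scalerDl scale1r dual_coefD // IH -natr1 mulrDl mul1r relation_latticeD.
case: m => k; first by rewrite (nat_case k).2 -pmulrn.
have [kL E] := nat_case k.+1.
rewrite NegzE scaleNr mulrNz mulNr -pmulrn -E.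
apply: (addrI (dual_coef i phi (k.+1%:Z *: v))).
by rewrite -dual_coefD ?relation_latticeN // !addrN.
Qed.
End Functional.

Lemma linear_functional (S : comNzRingType) (V : lmodType S) (f : V -> S) :
  (forall a u w, f (a *: u + w) = a * f u + f w) ->
  exists g : {linear V -> S^o}, forall u, g u = f u.
Proof.
move=> f_lin.
have flin : linear (f : V -> S^o) by move=> a u w; rewrite f_lin.
pose g : {linear V -> S^o} := HB.pack (f : V -> S^o)
  (GRing.isLinear.Build S V S^o *:%R (f : V -> S^o) flin).
by exists g.
Qed.

(** * Functionals of class zero, and a candidate for a nonzero class *)

Section ClassZero.
Variables (K : fieldType) (n : nat) (h : 'I_n -> nat).
Local Notation R := (semigroup_ring K h).
Local Notation L := (relation_lattice h).
Local Notation pol r := (sr_poly (r : R)).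
Local Notation dU := (Udifferential K h).
Variables (i : 'I_n).

(** Writing phi(u) as the sum of the u_j psi(dx_j), only j = i contributes: for j <> i a
    contribution would need a nonzero coefficient of t^(h_j - h_i) in psi(dx_j), but h_j - h_i is
    not in H. *)
Lemma class_zero_coef (phi : Umod K h -> R) :
  (forall j m, j != i -> in_semigroup h predT m -> h j <> (m + h i)%N) ->
  T1_class_zero phi ->
  exists mu : K, forall v : 'rV[int]_n, v \in L ->
    dual_coef i phi v = (v 0 i)%:~R * mu.
Proof.
(* The multiplier is the constant coefficient of psi(dx_i). *)
move=> h_i [psi E]; exists (pol (psi (delta_mx 0 i)))`_0 => v vL.
have {}E u : pol (phi u) = \sum_j Ucoord u j * pol (psi (delta_mx 0 j)).
  rewrite E {1}(row_sum_delta (Uval u)) raddf_sum.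
  have /= -> := raddf_sum (val : R -> {poly K}).
  apply: eq_bigr => j _; rewrite linearZ; exact: sr_polyM.
rewrite /dual_coef E mulr_sumr coef_sum.
have coef_term j : ('X^(h i) * (Ucoord (dU v) j * pol (psi (delta_mx 0 j))))`_(vdegree h v)
    = (v 0 j)%:~R * ('X^(h i) * pol (psi (delta_mx 0 j)))`_(h j).
  (* Shifting the index by h_j brings in the factor X^(h_j), for which the j-th coordinate of d f_v
     has a closed form. *)
  rewrite -(addnK (h j) (vdegree h v)).
  set q := pol (psi _).
  transitivity
    ('X^(h j) * ('X^(h i) * (Ucoord (dU v) j * q)))`_(vdegree h v + h j).
    by rewrite [RHS]coefXnM ltnNge leq_addl.
  rewrite mulrCA [_ * (Ucoord _ _ * _)]mulrA Ucoord_differential //.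
  rewrite -scalerAl -scalerAr coefZ.
  congr (_ * _); by rewrite mulrCA [LHS]coefXnM ltnNge leq_addr addKn.
rewrite (eq_bigr _ (fun j _ => coef_term j)) (bigD1 i) //= coefXnM ltnn subnn.
rewrite big1 ?addr0 // => j ji; rewrite coefXnM; case: ltnP => [|le_ij]; rewrite ?mulr0 //.
case: (eqVneq (pol (psi (delta_mx 0 j)))`_(h j - h i) 0) => [->|nz]; rewrite ?mulr0 //.
have /semigroup_polyP/(_ _ nz) := sr_polyP (psi (delta_mx 0 j) : R).
by move=> /(h_i j _ ji); lia.
Qed.

(** The functional psi is mu times the i-th coordinate; it agrees with phi on the generators d f_v,
    hence on U. Linearity is stated as an equation so that differences of functionals are covered as
    well. *)
Lemma class_zero_of_coef (phi : Umod K h -> R) (mu : K) :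
  (forall a u w, phi (a *: u + w) = a * phi u + phi w) ->
  (forall v : 'rV[int]_n, v \in L ->
     'X^(h i) * pol (phi (dU v)) = ((v 0 i)%:~R * mu) *: 'X^(vdegree h v)) ->
  T1_class_zero phi.
Proof.
move=> phi_lin phiE.
have [a u w|psi psiE] :=
    @linear_functional R 'rV[R]_n (fun u => mu *: u 0 i).
  by rewrite !mxE scalerDr scalerAr.
exists psi; apply: Umod_ind => [|a v u vL IH].
  have := phi_lin (-1) 0 0; rewrite scaler0 addr0 mulN1r addNr => ->.
  by rewrite psiE mxE scaler0.
rewrite phi_lin IH psiE psiE UvalD UvalZ !mxE scalerDr; congr (_ + _).
rewrite scalerAr; congr (_ * _); apply/sr_poly_inj/(@mulXnI K (h i)).
rewrite phiE // sr_polyZ -scalerAr (Ucoord_differential K i vL : _ * pol (Uval _ 0 i) = _).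
by rewrite scalerA mulrC.
Qed.

(* The functional u |-> t^(h_k - h_i) u_k; it maps d f_v to v(k) t^(h(v) - h_i). *)
Lemma shifted_coordinate (k : 'I_n) :
  (forall v : 'rV[int]_n, v \in L -> v != 0 ->
     exists2 m, in_semigroup h predT m & vdegree h v = (m + h i)%N) ->
  exists e : {linear Umod K h -> R^o},
    forall u, 'X^(h i) * pol (e u) = 'X^(h k) * Ucoord u k.
Proof.
move=> Hi.
have quot : forall u : Umod K h, exists r : R, 'X^(h i) * pol r = 'X^(h k) * Ucoord u k.
  apply: Umod_ind => [|a v u vL [r Er]].
    by exists 0; rewrite /Ucoord mxE !mulr0.
  suff [q Eq] : exists q : R, 'X^(h i) * pol q = 'X^(h k) * Ucoord (dU v) k.
    exists (a * q + r); rewrite sr_polyD sr_polyM UcoordD UcoordZ !mulrDr Er.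
    by rewrite mulrCA Eq mulrCA.
  rewrite Ucoord_differential //.
  have [->|/(Hi v vL)[m Hm ->]] := eqVneq v 0.
    by exists 0; rewrite mxE scale0r mulr0.
  by exists ((v 0 k)%:~R *: tpow K h m); rewrite sr_polyZ tpowE // -scalerAr -exprD addnC.
(* The quotients are unique, as X^(h_i) can be cancelled, so the chosen map is linear. *)
have [e eE] := choice quot.
have [a u w|g gE] := @linear_functional R (Umod K h) e.
  apply: sr_poly_inj; apply: (@mulXnI K (h i)) => /=.
  transitivity ('X^(h i) * (pol a * pol (e u) + pol (e w))).
    by rewrite eE UcoordD UcoordZ !mulrDr !(mulrCA _ (pol a)) !eE.
  by congr (_ * _); rewrite -sr_polyM; apply/esym/sr_polyD.
by exists g => u; rewrite gE eE.
Qed.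

Lemma shifted_coordinate_homog (k : 'I_n) (e : {linear Umod K h -> R^o}) :
  (forall u, 'X^(h i) * pol (e u) = 'X^(h k) * Ucoord u k) ->
  homogU_dual (- (h i)%:Z) e.
Proof.
move=> eE b u Hu m nz.
have := congr1 (fun p : {poly K} => p`_(h i + m)) (eE u).
rewrite !coefXnM ltnNge leq_addr /= addKn; case: ltnP => [_ E|le_k].
  by rewrite E eqxx in nz.
move=> E; rewrite E in nz; have := Hu k _ nz; lia.
Qed.
End ClassZero.

(** If h_j occurs in a representation of m, then m + h_i exceeds h_j; otherwise h_j would be a
    combination of the other generators. *)
Lemma minimal_generator_sub n (h : 'I_n -> nat) (i j : 'I_n) m :
  (forall i, ~~ in_semigroup h (predC1 i) (h i)) ->
  j != i -> in_semigroup h predT m -> h j <> (m + h i)%N.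
Proof.
move=> h_min ji /in_semigroupP[a ->] E.
have hi := generator_gt0 (h_min i).
have [aj|aj] := posnP (a j); last first.
  move: E; rewrite (bigD1 j) //=; nia.
apply/negP: (h_min j); rewrite negbK E (bigD1 j) //= aj mul0n add0n.
apply: in_semigroupD; last by apply: in_semigroup_gen; rewrite /= eq_sym.
by apply/in_semigroupP; exists a.
Qed.

(** * The component of T^1 in degree -h_i for three generators *)

Section TangentThree.
Variables (K : fieldType) (h : 'I_3 -> nat).
Hypothesis charK : [pchar K] =i pred0.
Hypothesis h_min : forall i : 'I_3, ~~ in_semigroup h (predC1 i) (h i).
Local Notation R := (semigroup_ring K h).
Local Notation L := (relation_lattice h).
Local Notation pol r := (sr_poly (r : R)).
Local Notation dU := (Udifferential K h).

Variables (i k l : 'I_3) (ikl : uniq [:: i; k; l]).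

Lemma relation_lattice3 (v : 'rV[int]_3) :
  (v \in L) = (v 0 i * (h i)%:Z + (v 0 k * (h k)%:Z + v 0 l * (h l)%:Z) == 0).
Proof. by rewrite inE (big_ord3 _ _ ikl). Qed.

(** The trivial relation between h_a and h_b. For distinct i, k, l the vectors [syzygy k l] and
    [syzygy i l] span L over the rationals, which replaces the choice of a basis of L. *)
Definition syzygy (a b : 'I_3) : 'rV[int]_3 :=
  (h b)%:Z *: delta_mx 0 a - (h a)%:Z *: delta_mx 0 b.

Lemma syzygyE a b j :
  syzygy a b 0 j = (h b)%:Z * (j == a)%:Z - (h a)%:Z * (j == b)%:Z.
Proof. by rewrite !mxE eqxx; do 2!case: eqP. Qed.

Lemma syzygyP a b : syzygy a b \in L.
Proof.
have sum_ind c : \sum_(j < 3) (j == c)%:Z * (h j)%:Z = (h c)%:Z.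
  rewrite (bigD1 c) //= eqxx mul1r big1 ?addr0 // => j /negPf ->.
  by rewrite mul0r.
rewrite inE; under eq_bigr do rewrite syzygyE mulrBl -!mulrA.
by rewrite sumrB -!mulr_sumr !sum_ind mulrC subrr.
Qed.

(** The vector h_l v equals v(k) [syzygy k l] + v(i) [syzygy i l]; in the l-th coordinate this is
    the relation satisfied by v. After division by h_l, two scalars determine all the others. *)
Lemma dual_coef_syzygy (phi : {linear Umod K h -> R^o}) (v : 'rV[int]_3) :
  homogU_dual (- (h i)%:Z) phi -> v \in L ->
  (h l)%:R * dual_coef i phi v =
    (v 0 k)%:~R * dual_coef i phi (syzygy k l)
    + (v 0 i)%:~R * dual_coef i phi (syzygy i l).
Proof.
move=> Hphi vL.
have scale_in m (w : 'rV[int]_3) : w \in L -> m *: w \in L.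
  rewrite !inE => /eqP w0; under eq_bigr do rewrite mxE -mulrA.
  by rewrite -mulr_sumr w0 mulr0.
rewrite -[(h l)%:R]/((h l)%:Z%:~R) -!dual_coefMz ?syzygyP //.
rewrite -dual_coefD ?scale_in ?syzygyP //; congr dual_coef.
have := ikl; rewrite /= !inE negb_or andbT => /andP[/andP[/negPf ik /negPf il] /negPf kl].
move: vL; rewrite relation_lattice3 => /eqP vL.
have ki : (k == i) = false by rewrite eq_sym.
have lk : (l == k) = false by rewrite eq_sym.
have li : (l == i) = false by rewrite eq_sym.
apply/rowP => j; rewrite mxE [RHS]mxE [X in _ = X + _]mxE [X in _ = _ + X]mxE !syzygyE.
have /or3P[/eqP ->|/eqP ->|/eqP ->] := ord3_cover j ikl;
  rewrite !(eqxx, ik, kl, il, ki, lk, li) /=; lia.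
Qed.

(** The scalar of phi at v must vanish. As v(i) = 0 and v(k) <> 0, so does the scalar at
    [syzygy k l], and what remains is a multiple of w |-> w(i). *)
Lemma T1_degree_zero_of (v : 'rV[int]_3) :
  v \in L -> v 0 i = 0 -> v != 0 ->
  (forall m, in_semigroup h predT m -> vdegree h v <> (m + h i)%N) ->
  T1_degree_zero K h (- (h i)%:Z).
Proof.
move=> vL vi v0 vH phi Hphi.
have vk0 : v 0 k != 0.
  apply: contra v0 => /eqP vk; apply/eqP/rowP => j; rewrite mxE.
  have := vL; rewrite relation_lattice3 vi vk !mul0r !add0r mulf_eq0.
  have /or3P[/eqP ->|/eqP ->|/eqP ->] := ord3_cover j ikl => //.
  by have := generator_gt0 (h_min l); case: (h l) => // m _; rewrite orbF => /eqP.
have hl0 : (h l)%:R != 0 :> K.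
  by rewrite ((GRing.pcharf0P K).1 charK) -lt0n (generator_gt0 (h_min l)).
have lam0 : dual_coef i phi v = 0.
  apply/eqP/negPn/negP; rewrite /dual_coef coefXnM.
  case: ltnP => [|le_i nz]; rewrite ?eqxx //.
  have /semigroup_polyP/(_ _ nz) Hm := sr_polyP (phi (dU v) : R).
  by apply: (vH _ Hm); rewrite subnK.
have syz0 : dual_coef i phi (syzygy k l) = 0.
  have := dual_coef_syzygy Hphi vL; rewrite lam0 vi mulr0 mul0r addr0.
  by move=> /esym/eqP; rewrite mulf_eq0 intr_eq0_char0 // (negPf vk0) => /eqP.
pose mu := dual_coef i phi (syzygy i l) / (h l)%:R.
apply: (@class_zero_of_coef _ _ _ i _ mu) => [a u w|w wL].
  by rewrite linearP.
rewrite dual_coefE //; congr (_ *: _); apply: (mulfI hl0).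
by rewrite dual_coef_syzygy // syz0 mulr0 add0r /mu mulrCA [_ * (_ / _)]mulrC divfK.
Qed.

Hypothesis i_divides : forall v : 'rV[int]_3, v \in L -> v != 0 ->
  exists2 m, in_semigroup h predT m & vdegree h v = (m + h i)%N.

Lemma T1_class :
  exists2 e : {linear Umod K h -> R^o}, homogU_dual (- (h i)%:Z) e &
    forall v : 'rV[int]_3, v \in L -> dual_coef i e v = (v 0 k)%:~R.
Proof.
have [e eE] := shifted_coordinate K k i_divides.
exists e; first exact: shifted_coordinate_homog eE.
move=> v vL; rewrite /dual_coef eE Ucoord_differential // coefZ coefXn eqxx mulr1 //.
Qed.

(** Class zero makes the scalars a multiple of v |-> v(i), and [syzygy k l] has i-th coordinate
    0. *)
Lemma class_zero_syzygy (phi : Umod K h -> R) :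
  T1_class_zero phi -> dual_coef i phi (syzygy k l) = 0.
Proof.
have i_min j m := @minimal_generator_sub 3 h i j m h_min.
case/(class_zero_coef i_min) => mu -> //; last exact: syzygyP.
have := ikl; rewrite /= !inE negb_or andbT => /andP[/andP[/negPf ik /negPf il] _].
by rewrite syzygyE ik il !mulr0 subrr mul0r.
Qed.

Lemma T1_degree_nonzero : ~ T1_degree_zero K h (- (h i)%:Z).
Proof.
have [e He eE] := T1_class => /(_ e He)/class_zero_syzygy.
rewrite eE ?syzygyP // => /eqP; rewrite intr_eq0_char0 // syzygyE eqxx.
have := ikl; rewrite /= !inE negb_or andbT => /andP[_ /negPf ->].
by have := generator_gt0 (h_min l); lia.
Qed.

Lemma T1_degree_dim1 : T1_degree_dim K h (- (h i)%:Z) 1.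
Proof.
have [e He eE] := T1_class.
exists (fun=> e); split=> // phi Hphi.
have hl0 : (h l)%:R != 0 :> K.
  by rewrite ((GRing.pcharf0P K).1 charK) -lt0n (generator_gt0 (h_min l)).
have wk : (syzygy k l) 0 k = (h l)%:Z.
  have := ikl; rewrite /= !inE negb_or andbT => /andP[_ /negPf kl].
  by rewrite syzygyE eqxx kl mulr1 mulr0 subr0.
have polE (x : 'rV[K]_1) u : pol (phi u - \sum_(j < 1) x 0 j *: (e u : R)) =
    pol (phi u) - x 0 0 *: pol (e u).
  by rewrite big_ord1 -scaleN1r sr_polyD !sr_polyZ scaleN1r.
have coef_sub (x : 'rV[K]_1) v : v \in L ->
    'X^(h i) * pol (phi (dU v) - \sum_(j < 1) x 0 j *: (e (dU v) : R)) =
    (dual_coef i phi v - x 0 0 * (v 0 k)%:~R) *: 'X^(vdegree h v).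
  move=> vL; rewrite polE mulrBr -scalerAr !dual_coefE // eE // scalerA.
  by rewrite -scalerBl.
(* On [syzygy k l] the functional e has scalar h_l, so this is the only multiple of e whose
   difference from phi has scalar 0 there. *)
exists (\row_j (dual_coef i phi (syzygy k l) / (h l)%:R)); split.
  pose mu := dual_coef i phi (syzygy i l) / (h l)%:R.
  apply: (@class_zero_of_coef _ _ _ i _ mu) => [a u w|v vL].
    apply: sr_poly_inj; rewrite [RHS]sr_polyD [in RHS]sr_polyM !polE.
    rewrite dualD dualZ dualD dualZ.
    by rewrite mulrBr scalerDr -!scalerAr opprD addrACA.
  rewrite coef_sub // mxE; congr (_ *: _); apply: (mulfI hl0).
  rewrite mulrBr dual_coef_syzygy // /mu.
  move: (dual_coef i phi (syzygy k l)) (dual_coef i phi (syzygy i l)) => a b.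
  by move: hl0 (v 0 k)%:~R (v 0 i)%:~R; move: (h l)%:R => d d0 x y; field.
move=> y /class_zero_syzygy; rewrite {1}/dual_coef coef_sub ?syzygyP //.
rewrite coefZ coefXn eqxx mulr1 wk => /eqP; rewrite subr_eq0 => /eqP E.
by apply/rowP => j; rewrite mxE ord1 E mulfK.
Qed.

End TangentThree.

(** * Generators of lattice ideals *)

Section IdealOf.
Variables (S : comNzRingType) (A : S -> Prop).

Lemma ideal_of_gen p : A p -> ideal_of A p.
Proof.
by exists 1%N, (fun=> 1), (fun=> p); split=> //; rewrite big_ord1 scale1r.
Qed.

Lemma ideal_of0 : ideal_of A 0.
Proof. by exists 0%N, (fun=> 0), (fun=> 0); split=> [[]|] //; rewrite big_ord0. Qed.

Lemma ideal_ofM a p : ideal_of A p -> ideal_of A (a * p).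
Proof.
move=> [m [b [g [Ag ->]]]]; exists m, (fun j => a * b j), g; split=> //.
by rewrite mulr_sumr; apply: eq_bigr => j _; rewrite /= -[RHS]mulrA.
Qed.

Lemma ideal_ofD p q : ideal_of A p -> ideal_of A q -> ideal_of A (p + q).
Proof.
move=> [m [b [g [Ag ->]]]] [m' [b' [g' [Ag' ->]]]].
exists (m + m')%N, (fun j => match split j with inl k => b k | inr k => b' k end),
  (fun j => match split j with inl k => g k | inr k => g' k end).
split=> [j|]; first by case: (split j).
rewrite big_split_ord /=; congr (_ + _); apply: eq_bigr => k _.
  by rewrite (unsplitK (inl _ k : 'I_m + 'I_m')%type).
by rewrite (unsplitK (inr _ k : 'I_m + 'I_m')%type).
Qed.

Lemma ideal_ofN p : ideal_of A p -> ideal_of A (- p).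
Proof. by move=> Ap; rewrite -mulN1r; apply: ideal_ofM. Qed.

Lemma ideal_of_ind (P : S -> Prop) :
  P 0 -> (forall a p q, A p -> P q -> P (a * p + q)) -> forall p, ideal_of A p -> P p.
Proof.
move=> P0 PD p [m [b [g [Ag ->]]]].
elim: m b g Ag => [|m IH] b g Ag; first by rewrite big_ord0.
by rewrite big_ord_recl; apply: PD => //; apply: IH.
Qed.
End IdealOf.

Lemma ideal_of_min (S : comNzRingType) (A B : S -> Prop) :
  (forall p, A p -> ideal_of B p) -> forall p, ideal_of A p -> ideal_of B p.
Proof.
move=> AB; apply: ideal_of_ind => [|a p q /AB Bp Bq]; first exact: ideal_of0.
by apply: ideal_ofD => //; apply: ideal_ofM.
Qed.

(** * Congruences of monomials along moves inside the orthant *)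

Definition nonneg n (a : 'rV[int]_n) : Prop := forall j, 0 <= a 0 j.

(** The end value bounds the first step: if y < 0, then x <= 0, so p x <= 0 and q y <= y, and b + y
    is at least the end value. *)
Lemma partial_step_ge0 (b x y p q : int) : 0 <= p -> 0 < q -> x <= 0 \/ y = 0 ->
  0 <= b -> 0 <= b + (p * x + q * y) -> 0 <= b + y.
Proof.
move=> p0 q0 xy b0; have [y0 _|y0] := lerP 0 y; first exact: addr_ge0.
have px : p * x <= 0 by case: xy => [x0|]; [rewrite mulr_ge0_le0 | lia].
have qy : q * y <= y by rewrite -subr_ge0 -[X in _ - X]mul1r; nia.
lia.
Qed.

Lemma step_ge0 (b y q : int) : 0 < q -> 0 <= b -> 0 <= b + q * y -> 0 <= b + y.
Proof.
move=> q0 b0 H; apply: (@partial_step_ge0 b 0 y 0 q) => //; first by left.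
by rewrite mul0r add0r.
Qed.

Section Monomials.
Variables (K : fieldType) (n : nat).
Implicit Types (a b g u v : 'rV[int]_n).
Local Notation bin := (@binomial_of K n).

Definition mon a : {mpoly K[n]} := \prod_(j < n) 'X_j ^+ `|a 0%R j|%N.

Definition pos_part v : 'rV[int]_n := \row_j (if 0 <= v 0 j then v 0 j else 0).

Lemma pos_part_ge0 v : nonneg (pos_part v).
Proof. by move=> j; rewrite mxE; case: ifP. Qed.

Lemma pos_partB v : pos_part v = pos_part (- v) + v.
Proof. by apply/rowP => j; rewrite !mxE; move: (v 0 j) => x; do 2!case: ifP; lia. Qed.

Lemma binomial_ofE v : bin v = mon (pos_part v) - mon (pos_part (- v)).
Proof.
congr (_ - _); rewrite big_mkcond; apply: eq_bigr => j _; rewrite !mxE.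
  by case: ifP.
by rewrite oppr_ge0; case: ifP; rewrite ?abszN.
Qed.

Lemma binomial_ofN v : bin (- v) = - bin v.
Proof. by rewrite !binomial_ofE opprK opprB. Qed.

Lemma mon_mul a b g :
  (forall j, `|g 0%R j|%N = (`|a 0%R j| + `|b 0%R j|)%N) ->
  mon g = mon a * mon b.
Proof. by move=> E; rewrite -big_split; apply: eq_bigr => j _; rewrite E exprD. Qed.

(** As b and b + g are both nonnegative, b dominates the negative part of g, and the remaining
    exponent gives a common monomial factor. *)
Lemma mon_step b g : nonneg b -> nonneg (b + g) ->
  mon (b + g) - mon b = mon (b - pos_part (- g)) * bin g.
Proof.
move=> b0 bg0; rewrite binomial_ofE mulrBr.
by congr (_ - _); apply: mon_mul => j; move: (b0 j) (bg0 j); rewrite !mxE ?opprK;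
  move: (b 0 j) (g 0 j) => x y; case: ifP; try case: ifP; lia.
Qed.

Variable A : {mpoly K[n]} -> Prop.
Definition congruent a b := ideal_of A (mon a - mon b).

Lemma congruent_sym a b : congruent a b -> congruent b a.
Proof. by rewrite /congruent -[mon b - _]opprB => /ideal_ofN. Qed.

Lemma congruent_trans b a g : congruent a b -> congruent b g -> congruent a g.
Proof.
move=> ab bg; rewrite /congruent -(subrK (mon b) (mon a)) -addrA.
exact: ideal_ofD.
Qed.

Lemma congruent_step b g : ideal_of A (bin g) -> nonneg b -> nonneg (b + g) ->
  congruent (b + g) b.
Proof. by move=> Ag b0 bg0; rewrite /congruent mon_step //; apply: ideal_ofM. Qed.

Lemma congruent_binomial v :
  congruent (pos_part (- v) + v) (pos_part (- v)) -> ideal_of A (bin v).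
Proof. by rewrite /congruent -pos_partB -binomial_ofE. Qed.

(* Multiples of v are used up first: where v is nonzero u is nonpositive, so these
   moves cannot leave the orthant; afterwards only multiples of u remain. *)
Lemma congruent_pair u v (p q : int) b :
  (forall j, u 0 j <= 0 \/ v 0 j = 0) ->
  ideal_of A (bin u) -> ideal_of A (bin v) ->
  nonneg b -> nonneg (b + (p *: u + q *: v)) ->
  congruent (b + (p *: u + q *: v)) b.
Proof.
move=> uv Au Av.
have [N] : exists N : nat, (`|p| + `|q| <= N)%N by exists (`|p| + `|q|)%N.
have main p' q' b' : (`|p'| + `|q'| <= N)%N -> 0 <= p' ->
    nonneg b' -> nonneg (b' + (p' *: u + q' *: v)) ->
    congruent (b' + (p' *: u + q' *: v)) b'.
  elim: N p' q' b' => [|N IH] {}p {}q {}b pqN p0 b0 e0.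
    have -> : p = 0 by lia.
    have -> : q = 0 by lia.
    rewrite !scale0r !addr0 /congruent subrr; exact: ideal_of0.
  have [q_gt0|q_lt0|q0] := ltrgt0P q.
  - have bv0 : nonneg (b + v).
      by move=> j; have := e0 j; rewrite !mxE; apply: partial_step_ge0.
    have E : b + (p *: u + q *: v) = b + v + (p *: u + (q - 1) *: v).
      by apply/rowP => j; rewrite !mxE; ring.
    apply: congruent_trans (congruent_step Av b0 bv0).
    rewrite E; apply: IH => //; first by lia.
    by rewrite -E.
  - have bv0 : nonneg (b - v).
      move=> j; have := e0 j; rewrite !mxE -[X in p * _ + X]mulrNN.
      apply: partial_step_ge0; rewrite ?oppr_gt0 //.
      by case: (uv j) => [|->]; [left | right; rewrite oppr0].
    have E : b + (p *: u + q *: v) = b - v + (p *: u + (q + 1) *: v).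
      by apply/rowP => j; rewrite !mxE; ring.
    have Av' : ideal_of A (bin (- v)) by rewrite binomial_ofN; apply: ideal_ofN.
    apply: congruent_trans (congruent_step Av' b0 bv0).
    rewrite E; apply: IH => //; first by lia.
    by rewrite -E.
  have [p_eq0|p_gt0] := eqVneq p 0.
    rewrite p_eq0 q0 !scale0r !addr0 /congruent subrr; exact: ideal_of0.
  have bu0 : nonneg (b + u).
    by move=> j; have := e0 j; rewrite !mxE q0 mul0r addr0; apply: step_ge0 => //; lia.
  have E : b + (p *: u + q *: v) = b + u + ((p - 1) *: u + q *: v).
    by apply/rowP => j; rewrite !mxE; ring.
  apply: congruent_trans (congruent_step Au b0 bu0).
  rewrite E; apply: IH => //; try by lia.
  by rewrite -E.
move=> pqN b0 e0; have [p0|p0] := lerP 0 p; first exact: main.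
(* For p < 0 the path is walked backwards from its end point, with both coefficients negated. *)
have E : b = b + (p *: u + q *: v) + ((- p) *: u + (- q) *: v).
  by apply/rowP => j; rewrite !mxE; ring.
apply: congruent_sym; rewrite {1}E; apply: main => //; try by lia.
by rewrite -E.
Qed.

Lemma pair_generates u v (p q : int) :
  (forall j, u 0 j <= 0 \/ v 0 j = 0) ->
  ideal_of A (bin u) -> ideal_of A (bin v) -> ideal_of A (bin (p *: u + q *: v)).
Proof.
move=> uv Au Av; apply: congruent_binomial; apply: congruent_pair => //.
  exact: pos_part_ge0.
by rewrite -pos_partB; apply: pos_part_ge0.
Qed.

(* As long as u and v both occur, the single move u + v stays in the orthant. *)
Lemma congruent_cone u v (p q : nat) b :
  (forall j, 0 <= (u + v) 0 j \/ u 0 j <= 0 /\ v 0 j <= 0) ->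
  ideal_of A (bin u) -> ideal_of A (bin v) -> ideal_of A (bin (u + v)) ->
  nonneg b -> nonneg (b + (p%:Z *: u + q%:Z *: v)) ->
  congruent (b + (p%:Z *: u + q%:Z *: v)) b.
Proof.
move=> uv Au Av Auv.
have [N] : exists N : nat, (p + q <= N)%N by exists (p + q)%N.
elim: N p q b => [|N IH] p q b pqN b0 e0.
  have -> : p = 0%N by lia.
  have -> : q = 0%N by lia.
  rewrite !scale0r !addr0 /congruent subrr; exact: ideal_of0.
case: p q pqN e0 => [|p] [|q] pqN e0.
- rewrite !scale0r !addr0 /congruent subrr; exact: ideal_of0.
- have bu0 : nonneg (b + v).
    by move=> j; have := e0 j; rewrite !mxE mul0r add0r; apply: step_ge0.
  have E : b + (0%N%:Z *: u + q.+1%:Z *: v) = b + v + (0%N%:Z *: u + q%:Z *: v).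
    by apply/rowP => j; rewrite !mxE !intS; ring.
  apply: congruent_trans (congruent_step Av b0 bu0).
  by rewrite E; apply: IH => //; rewrite -E.
- have bu0 : nonneg (b + u).
    by move=> j; have := e0 j; rewrite !mxE mul0r addr0; apply: step_ge0.
  have E : b + (p.+1%:Z *: u + 0%N%:Z *: v) = b + u + (p%:Z *: u + 0%N%:Z *: v).
    by apply/rowP => j; rewrite !mxE !intS; ring.
  apply: congruent_trans (congruent_step Au b0 bu0).
  by rewrite E; apply: IH; rewrite -?E //; lia.
have bu0 : nonneg (b + (u + v)).
  move=> j; have := e0 j; have := b0 j; have := uv j; rewrite !mxE !intS !mulrDl !mul1r.
  move=> [uv0 bj _|[uj vj]]; first exact: addr_ge0.
  have : p%:Z * u 0 j <= 0 by rewrite mulr_ge0_le0.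
  have : q%:Z * v 0 j <= 0 by rewrite mulr_ge0_le0.
  move: (p%:Z * u 0 j) (q%:Z * v 0 j) (u 0 j) (v 0 j) (b 0 j) => x y z t w; lia.
have E : b + (p.+1%:Z *: u + q.+1%:Z *: v) = b + (u + v) + (p%:Z *: u + q%:Z *: v).
  by apply/rowP => j; rewrite !mxE !intS; ring.
apply: congruent_trans (congruent_step Auv b0 bu0).
by rewrite E; apply: IH; rewrite -?E //; lia.
Qed.

(* In every coordinate at most one of u, v and -(u + v) is positive. *)
Lemma triple_generates u v (p q : int) :
  (forall j, [\/ u 0 j <= 0 /\ v 0 j <= 0, u 0 j <= 0 /\ 0 <= (u + v) 0 j
                | v 0 j <= 0 /\ 0 <= (u + v) 0 j]) ->
  ideal_of A (bin u) -> ideal_of A (bin v) -> ideal_of A (bin (u + v)) ->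
  ideal_of A (bin (p *: u + q *: v)).
Proof.
move=> uv Au Av Auv.
have Aw : ideal_of A (bin (- (u + v))) by rewrite binomial_ofN; apply: ideal_ofN.
have bin_in w :
    (forall b, nonneg b -> nonneg (b + w) -> congruent (b + w) b) ->
    ideal_of A (bin w).
  move=> Hw; apply/congruent_binomial/Hw; first exact: pos_part_ge0.
  by rewrite -pos_partB; apply: pos_part_ge0.
have main (p' q' : int) : 0 <= p' -> ideal_of A (bin (p' *: u + q' *: v)).
  case: p' => // {}p _; case: q' => {}q; apply: bin_in => b b0 e0.
    by apply: congruent_cone => // j; case: (uv j); rewrite !mxE; lia.
  (* For a negative coefficient of v, the pair u, -(u + v) replaces u, v: both coefficients become
     nonnegative, and the sum of the new pair is -v. *)
  have E : p%:Z *: u + Negz q *: v = (p + q.+1)%N%:Z *: u + q.+1%:Z *: (- (u + v)).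
    by apply/rowP => j; rewrite !mxE NegzE PoszD; ring.
  have Euw : u - (u + v) = - v by rewrite opprD addrA subrr add0r.
  rewrite E; apply: congruent_cone => //.
  - by move=> j; rewrite Euw; case: (uv j); rewrite !mxE; move: (u 0 j) (v 0 j) => x y; lia.
  - by rewrite Euw binomial_ofN; apply: ideal_ofN.
  by rewrite -E.
have [p0|p0] := lerP 0 p; first exact: main.
have -> : p *: u + q *: v = - ((- p) *: u + (- q) *: v).
  by apply/rowP => j; rewrite !mxE; ring.
by rewrite binomial_ofN; apply/ideal_ofN/main; lia.
Qed.
End Monomials.

(** * Zero-one points and minimality of generators *)

Section ZeroOnePoints.
Variables (K : fieldType) (n : nat) (Z : pred 'I_n).
Implicit Types (a v : 'rV[int]_n).

(* The coordinates in Z vanish, all others are 1. *)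
Definition zero_one_point (j : 'I_n) : K := (~~ Z j)%:R.
Local Notation z := zero_one_point.

(** Both monomials of f_v vanish at the point attached to Z. *)
Definition mixed v := (exists2 j, Z j & 0 < v 0 j) /\ (exists2 j, Z j & v 0 j < 0).
(** At the point attached to Z the first monomial of f_v is 1 and the second is 0. *)
Definition negative v := (forall j, Z j -> v 0 j <= 0) /\ (exists2 j, Z j & v 0 j < 0).

Lemma meval_mon a : (mon K a).@[z] = \prod_j z j ^+ `|a 0%R j|%N.
Proof.
by rewrite /mon rmorph_prod; apply: eq_bigr => j _; rewrite rmorphXn /= mevalXU.
Qed.

Lemma meval_mon0 a j : Z j -> a 0 j != 0 -> (mon K a).@[z] = 0.
Proof.
move=> Zj aj; rewrite meval_mon (bigD1 j) //= {1}/zero_one_point Zj.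
by rewrite expr0n absz_eq0 (negPf aj) mul0r.
Qed.

Lemma meval_mon1 a : (forall j, Z j -> a 0 j = 0) -> (mon K a).@[z] = 1.
Proof.
move=> a0; rewrite meval_mon big1 // => j _; rewrite /zero_one_point.
by case: (boolP (Z j)) => [/a0 ->|_]; rewrite ?expr1n.
Qed.

Lemma pos_part_neq0 v j : 0 < v 0 j -> pos_part v 0 j != 0.
Proof. by move=> vj; rewrite mxE ltW // gt_eqF. Qed.

Lemma mixed_meval v : mixed v -> (binomial_of K v).@[z] = 0.
Proof.
move=> [[j Zj vj] [k Zk vk]]; rewrite binomial_ofE mevalB.
rewrite (meval_mon0 Zj) ?pos_part_neq0 // (meval_mon0 Zk) ?subrr //.
by rewrite pos_part_neq0 // mxE oppr_gt0.
Qed.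

Lemma negative_meval v : negative v -> (binomial_of K v).@[z] != 0.
Proof.
move=> [v0 [k Zk vk]]; rewrite binomial_ofE mevalB.
rewrite meval_mon1 => [|j /v0 vj]; last by rewrite mxE; case: ifP => // ?; lia.
rewrite (meval_mon0 Zk) ?subr0 ?oner_eq0 //.
by rewrite pos_part_neq0 // mxE oppr_gt0.
Qed.
End ZeroOnePoints.

(** At the point attached to Z every generator but the j-th vanishes, hence so does the ideal of
    those generators, which therefore misses the j-th. *)
Lemma minimal_generators_of (K : fieldType) n (I : {mpoly K[n]} -> Prop) s
    (w : 'I_s -> 'rV[int]_n) :
  same_set (ideal_of (fun p => exists j, p = binomial_of K (w j))) I ->
  (forall j, exists Z, negative Z (w j) /\ forall k, k != j -> mixed Z (w k)) ->
  minimal_generators I (fun j => binomial_of K (w j)).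
Proof.
move=> gen Hmin; split=> // j E; have [Z [neg mix]] := Hmin j.
have /E : I (binomial_of K (w j)) by apply/gen/ideal_of_gen; exists j.
move/(ideal_of_ind (P := fun p => p.@[zero_one_point K Z] = 0)) => H.
move/eqP: (negative_meval K neg); apply; apply: H; first exact: meval0.
by move=> a p q [k kj ->] q0; rewrite mevalD mevalM (mixed_meval K (mix k kj)) mulr0 add0r.
Qed.

Lemma free_pair (F : fieldType) s (a b : 'rV[F]_s) j k :
  a 0 j * b 0 k - a 0 k * b 0 j != 0 -> free [:: a; b].
Proof.
move=> minor; rewrite free_cons span_seq1 seq1_free; apply/andP; split.
  apply: contra minor => /vlineP[x ->]; rewrite !mxE; apply/eqP; ring.
by apply: contra minor => /eqP ->; rewrite !mxE !mulr0 subrr.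
Qed.

(** * Lattices spanned by two vectors *)

Definition span2 n (u v : 'rV[int]_n) : {pred 'rV[int]_n} :=
  [pred x | `[< exists p q : int, x = p *: u + q *: v >]].

Lemma span2P n (u v x : 'rV[int]_n) :
  reflect (exists p q : int, x = p *: u + q *: v) (x \in span2 u v).
Proof. exact: asboolP. Qed.

Lemma span2_closed n (u v : 'rV[int]_n) : zmod_closed (span2 u v).
Proof.
split=> [|x y /span2P[p [q ->]] /span2P[p' [q' ->]]]; apply/span2P.
  by exists 0, 0; rewrite !scale0r addr0.
by exists (p - p'), (q - q'); rewrite !scalerBl opprD addrACA.
Qed.

(** Cramer's rule in the columns j and k. *)
Lemma minor_independent (R : idomainType) n (u v : 'rV[R]_n) j k (p q : R) :
  u 0 j * v 0 k - u 0 k * v 0 j != 0 -> p *: u + q *: v = 0 -> p = 0 /\ q = 0.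
Proof.
move=> minor E.
have coord t : p * u 0 t + q * v 0 t = 0.
  by have := congr1 (fun x : 'rV_n => x 0 t) E; rewrite !mxE.
split; apply: (mulIf minor); rewrite mul0r.
  transitivity ((p * u 0 j + q * v 0 j) * v 0 k - (p * u 0 k + q * v 0 k) * v 0 j).
    by ring.
  by rewrite !coord !mul0r subrr.
transitivity ((p * u 0 k + q * v 0 k) * u 0 j - (p * u 0 j + q * v 0 j) * u 0 k).
  by ring.
by rewrite !coord !mul0r subrr.
Qed.

Lemma span2_rank n (L : {pred 'rV[int]_n}) (u v : 'rV[int]_n) j k :
  (forall x, x \in L <-> exists p q : int, x = p *: u + q *: v) ->
  u 0 j * v 0 k - u 0 k * v 0 j != 0 -> lattice_rank L 2.
Proof.
move=> HL minor; pose B : 'M[int]_(2, n) := \matrix_(a < 2) (if a == 0 then u else v).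
have mulB (a : 'rV_2) : a *m B = a 0 0 *: u + a 0 1 *: v.
  rewrite mulmx_sum_row big_ord_recl big_ord1 !rowK.
  by congr (_ + _ *: _); congr (a _ _); apply: val_inj.
exists B; split; last first.
  move=> x; rewrite HL; split=> [[p [q ->]]|[a ->]]; last first.
    by exists (a 0 0), (a 0 1).
  by exists (\row_c (if c == 0 then p else q)); rewrite mulB !mxE.
apply: inj_row_free => a.
rewrite mulmx_sum_row big_ord_recl big_ord1 -!map_row !rowK => E.
have minorQ : map_mx intr u 0 j * map_mx intr v 0 k
    - map_mx intr u 0 k * map_mx intr v 0 j != 0 :> rat.
  by rewrite !mxE -!intrM -intrB intr_eq0.
have [a0 a1] := minor_independent minorQ E.
apply/rowP => c; rewrite mxE; case: c => [[|[|//]] lt_c].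
  by rewrite -[RHS]a0; congr (a _ _); apply: val_inj.
by rewrite -[RHS]a1; congr (a _ _); apply: val_inj.
Qed.

Lemma mulr_ge0_signs (x y : int) :
  0 <= x * y -> (0 <= x) && (0 <= y) || (x <= 0) && (y <= 0).
Proof.
case: (ltrgt0P x) => [x0|x0|->] /=; first by rewrite pmulr_rge0 // orbF.
  by rewrite nmulr_rge0.
by move=> _; case: (lerP 0 y) => // /ltW.
Qed.

Lemma rV_scaleI (R : idomainType) n (m : R) (x y : 'rV[R]_n) :
  m != 0 -> m *: x = m *: y -> x = y.
Proof.
move=> m0 E; apply/rowP => j; apply: (mulfI m0).
by have := congr1 (fun z : 'rV_n => z 0 j) E; rewrite !mxE.
Qed.

(** * Separations *)

Section Separation.
Variables (n : nat) (i : 'I_n).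
Implicit Types (v : 'rV[int]_n) (w : 'rV[int]_n.+1).

(* Moves the part d of the i-th coordinate of v to a new last coordinate. *)
Definition split_coord (d : int) v : 'rV[int]_n.+1 :=
  \row_j (if unlift ord_max j is Some j' then v 0 j' - (if j' == i then d else 0) else d).

Definition merge_coord w : 'rV[int]_n :=
  \row_j (w 0 (lift ord_max j) + (if j == i then w 0 ord_max else 0)).

Lemma split_coord_lift d v j :
  split_coord d v 0 (lift ord_max j) = v 0 j - (if j == i then d else 0).
Proof. by rewrite mxE liftK. Qed.

Lemma split_coord_max d v : split_coord d v 0 ord_max = d.
Proof. by rewrite mxE unlift_none. Qed.

Lemma split_coordK d : cancel (split_coord d) merge_coord.
Proof.
move=> v; apply/rowP => j; rewrite mxE split_coord_lift split_coord_max.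
by case: eqP => _; rewrite ?subrK ?subr0 ?addr0.
Qed.

Lemma merge_coordD w w' : merge_coord (w + w') = merge_coord w + merge_coord w'.
Proof.
by apply/rowP => j; rewrite !mxE; case: eqP => _; rewrite ?mxE ?addr0 // addrACA.
Qed.

Lemma merge_coordZ m w : merge_coord (m *: w) = m *: merge_coord w.
Proof.
by apply/rowP => j; rewrite !mxE; case: eqP => _; rewrite ?mxE ?addr0 ?mulrDr.
Qed.

Lemma split_coordN d v : split_coord (- d) (- v) = - split_coord d v.
Proof.
apply/rowP => j; rewrite !mxE; case: unliftP => [j' _|//].
by case: eqP => _; rewrite ?mxE; ring.
Qed.

Lemma split_coordD d d' v v' :
  split_coord (d + d') (v + v') = split_coord d v + split_coord d' v'.
Proof.
apply/rowP => j; rewrite !mxE; case: unliftP => [j' _|//].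
by case: eqP => _; rewrite ?mxE; ring.
Qed.

Lemma widen_ord_lift (j : 'I_n) : widen_ord (leqnSn n) j = lift ord_max j.
Proof. by apply: val_inj; rewrite /= /bump leqNgt ltn_ord. Qed.

Variable K : fieldType.

Lemma pi_map_mon w : nonneg w -> pi_map i (mon K w) = mon K (merge_coord w).
Proof.
move=> w0; rewrite /pi_map /mon rmorph_prod big_ord_recr /=.
under eq_bigr => j _ do
  rewrite rmorphXn /= comp_mpolyXU -tnth_nth tnth_mktuple widen_ord_lift liftK.
rewrite rmorphXn /= comp_mpolyXU -tnth_nth tnth_mktuple unlift_none.
have E j : 'X_j ^+ `|merge_coord w 0%R j|%N =
    'X_j ^+ `|w 0%R (lift ord_max j)|%N
    * (if j == i then 'X_i ^+ `|w 0%R ord_max|%N else 1) :> {mpoly K[n]}.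
  rewrite mxE; case: eqP => [->|_]; last by rewrite addr0 mulr1.
  by rewrite -exprD; congr (_ ^+ _); have := w0 (lift ord_max i); have := w0 ord_max; lia.
under [RHS]eq_bigr => j _ do rewrite E.
by rewrite big_split -big_mkcond big_pred1_eq.
Qed.

Lemma pi_mapB : {morph @pi_map K n i : p q / p - q}.
Proof. exact: comp_mpolyB. Qed.

Lemma pi_mapM : {morph @pi_map K n i : p q / p * q}.
Proof. exact: (rmorphM (comp_mpoly _)). Qed.

Lemma pi_map_surj (q : {mpoly K[n]}) : exists p, pi_map i p = q.
Proof.
(* A section of the projection: the old variables are kept under their new indices. *)
exists (comp_mpoly [tuple 'X_(lift ord_max j) | j < n] q).
rewrite /pi_map; elim/mpolyind: q => [|c m q _ _ IH]; first by rewrite !comp_mpoly0.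
rewrite !comp_mpolyD IH !comp_mpolyZ; congr (_ *: _ + _).
rewrite comp_mpolyX rmorph_prod [RHS]mpolyXE_id /=; apply: eq_bigr => j _.
by rewrite tnth_mktuple rmorphXn /= comp_mpolyXU -tnth_nth tnth_mktuple liftK.
Qed.

(** The two merged coordinates do not have opposite signs, so both stay in the same monomial and
    nothing cancels. *)
Lemma pi_map_binomial w : 0 <= w 0 (lift ord_max i) * w 0 ord_max ->
  pi_map i (binomial_of K w) = binomial_of K (merge_coord w).
Proof.
set x := w _ _; set y := w _ _ => wi; rewrite !binomial_ofE pi_mapB.
rewrite !pi_map_mon; try exact: pos_part_ge0.
have {}wi := mulr_ge0_signs wi; congr (mon K _ - mon K _); apply/rowP => j; rewrite !mxE.
  case: eqP => [->|_]; rewrite ?addr0 //; case: ifP; case: ifP; case: ifP; lia.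
case: eqP => [->|_]; rewrite ?mxE ?addr0 //; rewrite -?/x -?/y.
by move: (x) (y) wi => a b; case: ifP; case: ifP; case: ifP; lia.
Qed.

(** Without a sign condition the image may acquire a common monomial factor, but it is still a
    monomial times the binomial of the merged vector. *)
Lemma pi_map_binomial_in (L : {pred 'rV[int]_n}) w : merge_coord w \in L ->
  lattice_ideal L (pi_map i (binomial_of K w)).
Proof.
move=> wL; rewrite binomial_ofE pi_mapB !pi_map_mon; try exact: pos_part_ge0.
have Hge0 x : nonneg x -> nonneg (merge_coord x).
  by move=> x0 j; rewrite mxE addr_ge0 //; case: ifP.
rewrite {1}pos_partB merge_coordD; apply: congruent_step.
- by apply: ideal_of_gen; exists (merge_coord w).
- exact/Hge0/pos_part_ge0.
by rewrite -merge_coordD -pos_partB; apply/Hge0/pos_part_ge0.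
Qed.

(** Here L' is spanned by the two split vectors, and [merge_coord] carries it onto L. By the sign
    condition each generator maps to the binomial of its merged vector, and these generate I_L. The
    minor in d and e yields both the rank of L' and the independence in condition (iii). *)
Lemma separable_criterion (L : {pred 'rV[int]_n}) (u v : 'rV[int]_n) (d e : int) j k
    s (w : 'I_s -> 'rV[int]_n.+1) (a b : 'I_s) :
  zmod_closed L -> saturated L ->
  (forall x, x \in L <-> exists p q : int, x = p *: u + q *: v) ->
  u 0 j * v 0 k - u 0 k * v 0 j != 0 ->
  d * v 0 i - e * u 0 i != 0 ->
  w a = split_coord d u -> w b = split_coord e v ->
  (forall c, w c \in span2 (split_coord d u) (split_coord e v)) ->
  (forall c, 0 <= w c 0 (lift ord_max i) * w c 0 ord_max) ->
  (forall x, x \in L ->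
     ideal_of (fun p => exists c, p = binomial_of K (merge_coord (w c)))
       (binomial_of K x)) ->
  (forall p q : int, ideal_of (fun p => exists c, p = binomial_of K (w c))
     (binomial_of K (p *: split_coord d u + q *: split_coord e v))) ->
  (forall c, exists Z, negative Z (w c) /\ forall c', c' != c -> mixed Z (w c')) ->
  separable_at K L i.
Proof.
move=> L0 Lsat HL minor minor' wa wb w_in w_sign L_gen L'_gen w_min.
split=> //; set u' := split_coord d u in wa w_in L'_gen *.
set v' := split_coord e v in wb w_in L'_gen *.
have merge_in x : x \in span2 u' v' -> merge_coord x \in L.
  move=> /span2P[p [q ->]]; apply/HL; exists p, q.
  by rewrite merge_coordD !merge_coordZ !split_coordK.
have minor'_i : d * (v 0 i - e) - e * (u 0 i - d) != 0.
  by rewrite (_ : _ - _ = d * v 0 i - e * u 0 i) //; ring.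
have in_span p q : p *: u' + q *: v' \in span2 u' v' by apply/span2P; exists p, q.
exists (span2 u' v'); split.
- split=> [|m x m0 /span2P[p [q E]]]; first exact: span2_closed.
  (* Saturation is inherited from L: independence of u and v forces p = m p' and q = m q', and m is
     then cancelled. *)
  have /HL[p' [q' E']] : merge_coord x \in L.
    by apply: (Lsat m) => //; rewrite -merge_coordZ merge_in // E in_span.
  apply/span2P; exists p', q'; apply: (rV_scaleI m0); rewrite E scalerDr !scalerA.
  have [/eqP] : p - m * p' = 0 /\ q - m * q' = 0.
    apply: (minor_independent minor); rewrite !scalerBl addrACA -opprD.
    rewrite -!scalerA -scalerDr -E'.
    by rewrite -merge_coordZ E merge_coordD !merge_coordZ !split_coordK subrr.
  by rewrite subr_eq0 => /eqP -> /eqP; rewrite subr_eq0 => /eqP ->.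
- exists 2%N; split; last exact: span2_rank HL minor.
  apply: (@span2_rank _ _ u' v' ord_max (lift ord_max i)) => [x|].
    by split=> /span2P.
  by rewrite /u' /v' !split_coord_max !split_coord_lift eqxx [X in _ - X]mulrC.
- move=> q; split=> [[p Hp ->]|Hq].
    move: p Hp; apply: ideal_of_ind => [|a' p p' [x xL' ->] IH].
      by rewrite /pi_map comp_mpoly0; apply: ideal_of0.
    rewrite [pi_map _ _](comp_mpolyD) -!/(pi_map _ _) pi_mapM.
    by apply: ideal_ofD => //; apply/ideal_ofM/pi_map_binomial_in/merge_in.
  have {Hq} : ideal_of (fun p => exists c, p = binomial_of K (merge_coord (w c))) q.
    by move: q Hq; apply: ideal_of_min => p [x xL ->]; apply: L_gen.
  move: q; apply: ideal_of_ind => [|a' p p' [c ->] [q Hq ->]].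
    by exists 0; [apply: ideal_of0 | rewrite /pi_map comp_mpoly0].
  have [a'' <-] := pi_map_surj a'.
  exists (a'' * binomial_of K (w c) + q).
    by apply: ideal_ofD => //; apply/ideal_ofM/ideal_of_gen; exists (w c).
  by rewrite [RHS](comp_mpolyD) -!/(pi_map _ _) pi_mapM pi_map_binomial.
exists s, w; split=> //.
  apply: minimal_generators_of => // q; split.
    by apply: ideal_of_min => p [c ->]; apply: ideal_of_gen; exists (w c).
  by apply: ideal_of_min => p [x /span2P[p' [q' ->]] ->]; apply: L'_gen.
apply: (@free_pair _ _ _ _ a b); rewrite !mxE wa wb widen_ord_lift.
rewrite /u' /v' !split_coord_max !split_coord_lift eqxx.
by rewrite -!intrM -intrB intr_eq0.
Qed.
End Separation.

(** * Three-generated semigroups *)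

(** The case of two binomials: the conditions on d and e make the split vectors inherit the sign
    pattern of [pair_generates] and keep the two parts of each split coordinate from having opposite
    signs. *)
Lemma separable_pair (K : fieldType) n (i : 'I_n) (L : {pred 'rV[int]_n})
    (u v : 'rV[int]_n) (d e : int) j k :
  zmod_closed L -> saturated L ->
  (forall x, x \in L <-> exists p q : int, x = p *: u + q *: v) ->
  u 0 j * v 0 k - u 0 k * v 0 j != 0 ->
  d * v 0 i - e * u 0 i != 0 ->
  (forall t, u 0 t <= 0 \/ v 0 t = 0) ->
  u 0 i - d <= 0 \/ v 0 i - e = 0 -> d <= 0 \/ e = 0 ->
  0 <= (u 0 i - d) * d -> 0 <= (v 0 i - e) * e ->
  (exists Z, negative Z (split_coord i d u) /\ mixed Z (split_coord i e v)) ->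
  (exists Z, negative Z (split_coord i e v) /\ mixed Z (split_coord i d u)) ->
  separable_at K L i.
Proof.
move=> L0 Lsat HL minor minor' uv uvi de du ev Zu Zv.
pose w (a : 'I_2) := if a == 0 then split_coord i d u else split_coord i e v.
have w0 : w 0 = split_coord i d u by [].
have w1 : w 1 = split_coord i e v by [].
apply: (separable_criterion L0 Lsat HL minor minor' w0 w1).
- move=> a; rewrite /w; case: eqP => _; apply/span2P.
    by exists 1, 0; rewrite scale1r scale0r addr0.
  by exists 0, 1; rewrite scale1r scale0r add0r.
- by move=> a; rewrite /w; case: eqP => _; rewrite split_coord_lift split_coord_max eqxx.
- move=> x /HL[p [q ->]]; apply: pair_generates => //; apply: ideal_of_gen.
    by exists 0; rewrite w0 split_coordK.
  by exists 1; rewrite w1 split_coordK.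
- move=> p q; apply: pair_generates; last 2 first.
  + by apply: ideal_of_gen; exists 0.
  + by apply: ideal_of_gen; exists 1.
  move=> t; case: (unliftP ord_max t) => [t' ->|->]; last by rewrite !split_coord_max.
  rewrite !split_coord_lift; case: eqP => [->|_] //.
  by rewrite !subr0.
move=> a; rewrite {1}/w; case: eqP => [->|a0].
  have [Z [neg mix]] := Zu; exists Z; split=> // b b0.
  by rewrite /w (negPf b0).
have [Z [neg mix]] := Zv; exists Z; split=> // b ba.
have -> : b = 0.
  apply: val_inj; move/eqP: a0 ba (ltn_ord a) (ltn_ord b).
  by rewrite -!val_eqE /=; lia.
by rewrite w0.
Qed.

(** * Numerical consequences of the minimality of the c_i *)

Section Numerics.
Variables (h c : 'I_3 -> nat) (r : 'I_3 -> 'I_3 -> nat).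
Hypothesis h_min : forall i : 'I_3, ~~ in_semigroup h (predC1 i) (h i).
Hypothesis c_min : forall i : 'I_3, smallest_multiple h i (c i).
Hypothesis r_rel : forall i : 'I_3, (c i * h i = \sum_(j < 3 | j != i) r i j * h j)%N.
Local Notation L := (relation_lattice h).
Variables (i k l : 'I_3) (ikl : uniq [:: i; k; l]).

Lemma c_gt0 j : (0 < c j)%N.
Proof. by have [] := c_min j. Qed.

Lemma c_le (m a b : nat) : (0 < m)%N -> (m * h i = a * h k + b * h l)%N -> (c i <= m)%N.
Proof.
move=> m0 E; have [_ _] := c_min i; apply=> //; apply/in_semigroupP.
exists (fun j => if j == k then a else b).
have := ikl; rewrite /= !inE negb_or andbT => /andP[_ /negPf kl].
by rewrite (big_ord3_neq _ _ ikl) eqxx [l == k]eq_sym kl.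
Qed.

Lemma r_relE : (c i * h i = r i k * h k + r i l * h l)%N.
Proof. by rewrite r_rel (big_ord3_neq _ _ ikl). Qed.

(** The relation reads v(k) h_k = - v(l) h_l, so both terms have the same absolute value, which is
    h(v). *)
Lemma vdegree_kl (v : 'rV[int]_3) : v \in L -> v 0 i = 0 ->
  vdegree h v = (`|v 0%R k| * h k)%N /\ vdegree h v = (`|v 0%R l| * h l)%N.
Proof.
rewrite (relation_lattice3 h ikl) => vL vi; move: vL; rewrite vi mul0r add0r => /eqP vL.
have hk := generator_gt0 (h_min k); have hl := generator_gt0 (h_min l).
rewrite /vdegree big_mkcond (big_ord3 _ _ ikl) vi /= ?absz0 ?mul0n ?add0n.
move: (v 0 k) (v 0 l) vL => x y vL.
case: (lerP 0 x) => x0; case: (lerP 0 y) => y0; split; nia.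
Qed.

Lemma in_semigroup3 a b d : in_semigroup h predT (a * h i + b * h k + d * h l)%N.
Proof.
by rewrite !in_semigroupD // in_semigroupM // in_semigroup_gen.
Qed.
End Numerics.

Section Divisibility.
Variables (h c : 'I_3 -> nat) (r : 'I_3 -> 'I_3 -> nat).
Hypothesis h_min : forall i : 'I_3, ~~ in_semigroup h (predC1 i) (h i).
Hypothesis c_min : forall i : 'I_3, smallest_multiple h i (c i).
Hypothesis r_rel : forall i : 'I_3, (c i * h i = \sum_(j < 3 | j != i) r i j * h j)%N.
Local Notation L := (relation_lattice h).
Variables (i k l : 'I_3) (ikl : uniq [:: i; k; l]).

(** Only v(i) = 0 needs an argument. Then h(v) = |v(k)| h_k = |v(l)| h_l, and minimality gives c_k
    <= |v(k)| and c_l <= |v(l)|. Rewriting c_k h_k or c_l h_l by its chosen relation makes h_i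
    appear. *)
Lemma vdegree_divisible (v : 'rV[int]_3) :
  r k i != 0%N \/ r l i != 0%N -> v \in L -> v != 0 ->
  exists2 m, in_semigroup h predT m & vdegree h v = (m + h i)%N.
Proof.
move=> rki vL v0; have [vi|] := eqVneq (v 0 i) 0; last exact: vdegree_relation vL.
have [ilk kil kli lik lki] := uniq3_perm ikl.
have [Ek El] := vdegree_kl h_min ikl vL vi.
have hk := generator_gt0 (h_min k); have hl := generator_gt0 (h_min l).
have vk : v 0 k != 0.
  apply: contra v0 => /eqP vk; apply/eqP/rowP => j; rewrite mxE.
  have vl : v 0 l = 0 by move: El; rewrite Ek vk /=; nia.
  by have /or3P[/eqP ->|/eqP ->|/eqP ->] := ord3_cover j ikl.
case: rki => [rki|rli].
  have ck := c_le c_min kil (m := `|v 0%R k|) (a := 0) (b := `|v 0%R l|).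
  have {}ck : (c k <= `|v 0%R k|)%N by apply: ck; lia.
  (* One copy of h_i is removed from r_ki h_i, hence the predecessor. *)
  exists ((r k i).-1 * h i + (`|v 0%R k| - c k) * h k + r k l * h l)%N.
    exact: in_semigroup3.
  rewrite Ek -[X in (X * h k)%N](subnKC ck) mulnDl (r_relE r_rel kil).
  by move: rki; case: (r k i) => // a _; rewrite mulSn /=; lia.
have cl := c_le c_min lik (m := `|v 0%R l|) (a := 0) (b := `|v 0%R k|).
have {}cl : (c l <= `|v 0%R l|)%N by apply: cl; nia.
exists ((r l i).-1 * h i + r l k * h k + (`|v 0%R l| - c l) * h l)%N.
  exact: in_semigroup3.
rewrite El -[X in (X * h l)%N](subnKC cl) mulnDl (r_relE r_rel lik).
by move: rli; case: (r l i) => // a _; rewrite mulSn /=; lia.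
Qed.

(** If c_k h_k involved h_i, cancelling h_k or h_l would contradict the minimality of c_k or c_l, so
    c_k h_k would be a multiple of h_i, with coefficient at least c_i. Replacing c_i h_i by r_ik h_k
    + r_il h_l and cancelling r_ik h_k contradicts the minimality of c_k again. *)
Lemma vdegree_not_divisible m : (c k * h k = c l * h l)%N ->
  r i k != 0%N -> r i l != 0%N -> in_semigroup h predT m ->
  (c k * h k <> m + h i)%N.
Proof.
move=> Ekl rik ril /in_semigroupP[a ->] E.
have {}E : (c k * h k = (a i).+1 * h i + a k * h k + a l * h l)%N.
  by rewrite E (big_ord3 _ _ ikl) /= mulSn; lia.
have [ilk kil kli lik lki] := uniq3_perm ikl.
have hi := generator_gt0 (h_min i).
have hk := generator_gt0 (h_min k); have hl := generator_gt0 (h_min l).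
have ak : a k = 0%N.
  apply/eqP; rewrite -leqn0 leqNgt; apply/negP => ak.
  have ltk : (a k < c k)%N by nia.
  have := c_le c_min kil (m := c k - a k) (a := (a i).+1) (b := a l).
  by rewrite subn_gt0 ltk mulnBl E => /(_ isT); lia.
have al : a l = 0%N.
  apply/eqP; rewrite -leqn0 leqNgt; apply/negP => al.
  have ltl : (a l < c l)%N by nia.
  have := c_le c_min lik (m := c l - a l) (a := (a i).+1) (b := a k).
  by rewrite subn_gt0 ltl mulnBl -Ekl E => /(_ isT); lia.
rewrite ak al !mul0n !addn0 in E.
have ci : (c i <= (a i).+1)%N.
  by apply: (c_le c_min ikl (a := c k) (b := 0%N)); rewrite // mul0n addn0.
have ri := r_relE r_rel ikl.
have E' : (c k * h k = ((a i).+1 - c i) * h i + r i k * h k + r i l * h l)%N.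
  by rewrite E -[X in (X * h i)%N](subnK ci) mulnDl ri addnA.
(* The inequality is strict because r_il h_l > 0 also occurs on the right. *)
have rk : (r i k < c k)%N by rewrite -lt0n in ril; nia.
have := c_le c_min kil (m := c k - r i k) (a := (a i).+1 - c i) (b := r i l).
by rewrite subn_gt0 rk mulnBl E' => /(_ isT); lia.
Qed.
End Divisibility.

Lemma relation_lattice_saturated n (h : 'I_n -> nat) : saturated (relation_lattice h).
Proof.
move=> m v m0; rewrite !inE; under eq_bigr do rewrite mxE -mulrA.
by rewrite -mulr_sumr mulf_eq0 (negPf m0).
Qed.

Lemma negative_seq n (s : seq 'I_n) (v : 'rV[int]_n) :
  all (fun j => v 0 j <= 0) s && has (fun j => v 0 j < 0) s ->
  negative (fun j => j \in s) v.
Proof. by case/andP=> /allP neg /hasP. Qed.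

Lemma mixed_seq n (s : seq 'I_n) (v : 'rV[int]_n) :
  has (fun j => 0 < v 0 j) s && has (fun j => v 0 j < 0) s ->
  mixed (fun j => j \in s) v.
Proof. by case/andP=> /hasP pos /hasP. Qed.

(** * Explicit separations in the three cases *)

Section Separability.
Variables (K : fieldType) (h c : 'I_3 -> nat) (r : 'I_3 -> 'I_3 -> nat).
Hypothesis c_gt0 : forall i, (0 < c i)%N.
Hypothesis v_gen : forall w : 'rV[int]_3,
  w \in relation_lattice h <-> exists a : 'rV[int]_3, w = a *m relmx c r.
Local Notation L := (relation_lattice h).
Local Notation v j := (row j (relmx c r)).
Variables (i k l : 'I_3) (ikl : uniq [:: i; k; l]).

Lemma relmxE a b : (v a) 0 b = if b == a then (c a)%:Z else - (r a b)%:Z.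
Proof. by rewrite !mxE. Qed.

Lemma lattice_gen (x : 'rV[int]_3) :
  x \in L <-> exists p q s : int, x = p *: v i + (q *: v k + s *: v l).
Proof.
rewrite v_gen; split=> [[a ->]|[p [q [s ->]]]].
  by exists (a 0 i), (a 0 k), (a 0 l); rewrite mulmx_sum_row (big_ord3 _ _ ikl).
exists (\row_j (if j == i then p else if j == k then q else s)).
have [[ki ik li il kl] lk] := uniq3_neq ikl.
by rewrite mulmx_sum_row (big_ord3 _ _ ikl) !mxE !eqxx ki li lk.
Qed.

(** Off-diagonal entries are nonpositive, so two of them with sum 0 vanish. *)
Lemma opposite_rows a b x :
  v a + v b = 0 -> x != a -> x != b -> r a x = 0%N /\ r b x = 0%N.
Proof.
move=> E /negPf xa /negPf xb; have := congr1 (fun y : 'rV_3 => y 0 x) E.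
by rewrite !mxE xa xb; move: (r a x) (r b x) => m n; clear; lia.
Qed.

Lemma opposite_rows_diag a b : v a + v b = 0 -> a != b -> r a b = c b.
Proof.
move=> E /negPf ab; have := congr1 (fun y : 'rV_3 => y 0 b) E.
by rewrite !mxE eq_sym ab eqxx; move: (r a b) (c b) => m n; clear; lia.
Qed.

(* With y the new variable, I_L' = (x_i^c_i - y^r_ik x_l^r_il, x_k^c_k - x_l^c_l). *)
Lemma separable_complete_intersection :
  v k + v l = 0 -> r i k != 0%N -> r i l != 0%N -> separable_at K L k.
Proof.
move=> vkl rik ril; have [[ki ik li il kl] lk] := uniq3_neq ikl.
have vl : v l = - v k by apply/eqP; rewrite -addr_eq0 addrC vkl.
have vE := (relmxE, eqxx, ki, ik, li, il, kl, lk).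
have [rki _] : r k i = 0%N /\ r l i = 0%N.
  by apply: opposite_rows; rewrite ?ik ?il.
have rkl : r k l = c l by apply: opposite_rows_diag; rewrite ?kl.
have ci := c_gt0 i; have ck := c_gt0 k; have cl := c_gt0 l.
apply: (@separable_pair K 3 k L (v i) (v k) (- (r i k)%:Z) 0 i k).
- exact: relation_lattice_closed.
- exact: relation_lattice_saturated.
- move=> x; rewrite lattice_gen; split=> [[p [q [s ->]]]|[p [q ->]]].
    by exists p, (q - s); rewrite vl scalerBl scalerN.
  by exists p, q, 0; rewrite scale0r addr0.
- rewrite !vE; nia.
- rewrite !vE; nia.
- by move=> t; have /or3P[/eqP ->|/eqP ->|/eqP ->] := ord3_cover t ikl; rewrite !vE; lia.
- rewrite !vE; lia.
- lia.
- rewrite !vE; lia.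
- by rewrite mulr0.
(* On these coordinates the split [v i] has entries 0 and -r_il, while [v k] has entries c_k and
   -c_l. *)
- exists (fun j => j \in [:: lift ord_max k; lift ord_max l]).
  split; [apply: negative_seq | apply: mixed_seq];
    by rewrite /= !split_coord_lift !vE; lia.
exists (fun j => j \in [:: lift ord_max i; lift ord_max l]).
split; [apply: negative_seq | apply: mixed_seq];
  by rewrite /= !split_coord_lift !vE; lia.
Qed.

(* With y the new variable, I_L' = (x_i^c_i - x_k^c_k, y^c_i - x_l^c_l). *)
Lemma separable_pure_powers :
  v i = (c i)%:Z *: delta_mx 0 i - (c k)%:Z *: delta_mx 0 k ->
  v k = (c k)%:Z *: delta_mx 0 k - (c l)%:Z *: delta_mx 0 l ->
  v l = (c l)%:Z *: delta_mx 0 l - (c i)%:Z *: delta_mx 0 i ->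
  separable_at K L i.
Proof.
move=> vi vk vl; have [[ki ik li il kl] lk] := uniq3_neq ikl.
have ci := c_gt0 i; have ck := c_gt0 k; have cl := c_gt0 l.
have vE := (mxE, vi, vl, eqxx, ki, ik, li, il, kl, lk).
(* The signs are reversed because [v i] and [v l] themselves violate the sign pattern at i. The
   whole i-th coordinate of - [v l] moves to the new variable. *)
apply: (@separable_pair K 3 i L (- v i) (- v l) 0 (c i)%:Z k l).
- exact: relation_lattice_closed.
- exact: relation_lattice_saturated.
- move=> x; rewrite lattice_gen.
  have -> : v k = - v i - v l by rewrite vi vk vl; apply/rowP => j; rewrite !mxE; ring.
  split=> [[p [q [s ->]]]|[p [q ->]]].
    by exists (q - p), (q - s); apply/rowP => j; rewrite !mxE; ring.
  by exists (- p), 0, (- q); rewrite scale0r add0r !scalerN !scaleNr.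
- rewrite !vE /=; nia.
- rewrite !vE /=; nia.
- by move=> t; have /or3P[/eqP ->|/eqP ->|/eqP ->] := ord3_cover t ikl; rewrite !vE /=; lia.
- rewrite !vE /=; lia.
- lia.
- rewrite !vE /=; lia.
- rewrite !vE /=; lia.
- exists (fun j => j \in [:: lift ord_max i; lift ord_max l; ord_max]).
  split; [apply: negative_seq | apply: mixed_seq];
    by rewrite /= !split_coord_lift !split_coord_max !vE /=; lia.
exists (fun j => j \in [:: lift ord_max i; lift ord_max k; lift ord_max l]).
split; [apply: negative_seq | apply: mixed_seq];
  by rewrite /= !split_coord_lift !vE /=; lia.
Qed.

(* As c_i = r_ki + r_li, one can turn x_i^r_li into y^r_li, with y the new variable:
   I_L' is generated by x_i^r_ki y^r_li - x_k^r_ik x_l^r_il, f_(v_k) and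
   x_l^c_l - y^r_li x_k^r_lk. *)
Lemma separable_determinantal :
  (forall a b, a != b -> r a b != 0%N) -> v i + (v k + v l) = 0 ->
  separable_at K L i.
Proof.
move=> r0 v0; have [[ki ik li il kl] lk] := uniq3_neq ikl.
have ci := c_gt0 i; have ck := c_gt0 k; have cl := c_gt0 l.
have vE := (relmxE, eqxx, ki, ik, li, il, kl, lk).
have coord j : v i 0 j + (v k 0 j + v l 0 j) = 0.
  by have := congr1 (fun x : 'rV_3 => x 0 j) v0; rewrite !mxE.
(* Each c equals the sum of the two r in its column; in particular c_i - r_li = r_ki. *)
have := coord i; have := coord k; have := coord l; rewrite !vE => el ek ei.
have rne a b : (a == b) = false -> (0 < r a b)%N by move=> ab; rewrite lt0n r0 // ab.
have := rne _ _ ik; have := rne _ _ il; have := rne _ _ ki.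
have := rne _ _ kl; have := rne _ _ li; have := rne _ _ lk.
move=> rlk rli rkl rki ril rik.
have vk : v k = - (v i + v l).
  by apply/eqP; rewrite -addr_eq0 addrC -addrA [v l + _]addrC v0.
(* The moved parts have sum 0, so the three split vectors again have sum 0. *)
pose d a : int := if a == i then (r l i)%:Z else if a == l then - (r l i)%:Z else 0.
pose w a := split_coord i (d a) (v a).
have di : d i = r l i by rewrite /d eqxx.
have dk : d k = 0 by rewrite /d ki kl.
have dl : d l = - (r l i)%:Z by rewrite /d li eqxx.
have wi : w i = split_coord i (r l i)%:Z (v i) by rewrite /w di.
have wl : w l = split_coord i (- (r l i)%:Z) (v l) by rewrite /w dl.
have wk : w k = - (w i + w l).
  by rewrite wi wl -split_coordD subrr -split_coordN oppr0 /w dk vk.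
have addE m (x y : 'rV[int]_m) j : (x + y) 0 j = x 0 j + y 0 j by rewrite mxE.
have all3 (P : 'I_3 -> Prop) : P i -> P k -> P l -> forall a, P a.
  by move=> Pi Pk Pl a; have /or3P[/eqP ->|/eqP ->|/eqP ->] := ord3_cover a ikl.
apply: (@separable_criterion 3 i K L (v i) (v l) (r l i) (- (r l i)%:Z) i l 3 w i l) => //.
- exact: relation_lattice_closed.
- exact: relation_lattice_saturated.
- move=> x; rewrite lattice_gen; split=> [[p [q [s ->]]]|[p [q ->]]].
    by exists (p - q), (s - q); rewrite vk; apply/rowP => j; rewrite !mxE; ring.
  by exists p, 0, q; rewrite scale0r add0r.
- rewrite !vE; nia.
- rewrite !vE; nia.
- rewrite -wi -wl; apply: (all3); apply/span2P.
  + by exists 1, 0; rewrite scale1r scale0r addr0.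
  + by exists (-1), (-1); rewrite wk !scaleN1r opprD.
  by exists 0, 1; rewrite scale1r scale0r add0r.
- apply: (all3); rewrite /w split_coord_lift split_coord_max ?di ?dk ?dl !vE; nia.
- move=> x /lattice_gen[p [q [s ->]]].
  have -> : p *: v i + (q *: v k + s *: v l) = (p - q) *: v i + (s - q) *: v l.
    by rewrite vk; apply/rowP => j; rewrite !mxE; ring.
  apply: triple_generates.
  (* The sum of [v i] and [v l] is - [v k]: it is nonnegative at i and l, while at k both summands
     are negative. *)
  + by apply: (all3); rewrite addE !vE;
      [constructor 3 | constructor 1 | constructor 2]; lia.
  + by apply: ideal_of_gen; exists i; rewrite /w split_coordK.
  + by apply: ideal_of_gen; exists l; rewrite /w split_coordK.
  rewrite -[_ + _]opprK -vk binomial_ofN; apply: ideal_ofN.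
  by apply: ideal_of_gen; exists k; rewrite /w split_coordK.
- move=> p q; rewrite -wi -wl; apply: triple_generates.
  + move=> t; rewrite wi wl addE; case: (unliftP ord_max t) => [t' ->|->]; last first.
      by rewrite !split_coord_max; constructor 3; lia.
    by rewrite !split_coord_lift; move: t'; apply: (all3); rewrite !vE;
      [constructor 3 | constructor 1 | constructor 2]; lia.
  + by apply: ideal_of_gen; exists i.
  + by apply: ideal_of_gen; exists l.
  by rewrite -[_ + _]opprK -wk binomial_ofN; apply/ideal_ofN/ideal_of_gen; exists k.
apply: (all3).
(* Each zero set consists of the variables of the second monomial of the isolated binomial, together
   in the last two cases with coordinates where its vector is 0. *)
- exists (fun j => j \in [:: lift ord_max k; lift ord_max l]); split.
    by apply: negative_seq; rewrite /= !split_coord_lift !vE; lia.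
  apply: (all3); rewrite ?eqxx // => _; apply: mixed_seq;
    by rewrite /= !split_coord_lift !vE; lia.
- exists (fun j => j \in [:: lift ord_max i; lift ord_max l; ord_max]); split.
    by apply: negative_seq; rewrite /= !split_coord_lift !split_coord_max dk !vE; lia.
  apply: (all3); rewrite ?eqxx // => _; apply: mixed_seq;
    by rewrite /= !split_coord_lift !split_coord_max ?di ?dl !vE; lia.
exists (fun j => j \in [:: lift ord_max i; lift ord_max k; ord_max]); split.
  by apply: negative_seq; rewrite /= !split_coord_lift !split_coord_max dl !vE; lia.
apply: (all3); rewrite ?eqxx // => _; apply: mixed_seq;
  by rewrite /= !split_coord_lift !split_coord_max ?di ?dk !vE; lia.
Qed.

End Separability.

(** * The ideal in the complete intersection case and the final case analysis *)

Lemma binomial_relation_row (K : fieldType) (c : 'I_3 -> nat) (r : 'I_3 -> 'I_3 -> nat)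
    (i k l : 'I_3) : uniq [:: i; k; l] ->
  binomial_of K (row i (relmx c r)) = 'X_i ^+ c i - 'X_k ^+ r i k * 'X_l ^+ r i l.
Proof.
move=> ikl; have [[ki ik li il kl] lk] := uniq3_neq ikl.
rewrite binomial_ofE /mon !(big_ord3 _ _ ikl) /= !(mxE, eqxx, ki, li) /=.
have nn (m : nat) : (if (0 <= - m%:Z)%R then - m%:Z else 0) = 0 by case: ifP; lia.
by rewrite !nn !opprK /= !expr0 !mulr1 mul1r.
Qed.

(** As [v l] = - [v k], the rows i and k generate L, and [v k] has entries 0, c_k, -c_l. The row i
    is positive only at i, where [v k] vanishes, so [pair_generates] applies. *)
Lemma complete_intersection_formI (K : fieldType) (h c : 'I_3 -> nat)
    (r : 'I_3 -> 'I_3 -> nat) (i k l : 'I_3) :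
  (forall j, (0 < c j)%N) ->
  (forall w : 'rV[int]_3,
     w \in relation_lattice h <-> exists a : 'rV[int]_3, w = a *m relmx c r) ->
  uniq [:: i; k; l] ->
  row k (relmx c r) + row l (relmx c r) = 0 -> r i k != 0%N -> r i l != 0%N ->
  complete_intersection_form K h c r i k l.
Proof.
move=> c_gt0 v_gen ikl vkl rik ril; have [[ki ik li il kl] lk] := uniq3_neq ikl.
have [_ _ kli _ _] := uniq3_perm ikl.
have vl : row l (relmx c r) = - row k (relmx c r).
  by apply/eqP; rewrite -addr_eq0 addrC vkl.
have vE := (relmxE, eqxx, ki, ik, li, il, kl, lk).
have [rki _] : r k i = 0%N /\ r l i = 0%N.
  by apply: (opposite_rows vkl); rewrite ?ik ?il.
have rkl : r k l = c l by apply: (opposite_rows_diag vkl); rewrite kl.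
have Ei := binomial_relation_row K c r ikl.
have Ek : binomial_of K (row k (relmx c r)) = 'X_k ^+ c k - 'X_l ^+ c l.
  by rewrite (binomial_relation_row K c r kli) rki rkl expr0 mulr1.
have vL := lattice_gen v_gen ikl.
split=> // p; split.
  apply: ideal_of_min => q [x /vL[a [b [s ->]]] ->].
  have -> : a *: row i (relmx c r) + (b *: row k (relmx c r) + s *: row l (relmx c r)) =
      a *: row i (relmx c r) + (b - s) *: row k (relmx c r).
    by rewrite vl scalerBl scalerN.
  apply: pair_generates.
  - by move=> t; have /or3P[/eqP ->|/eqP ->|/eqP ->] := ord3_cover t ikl; rewrite !vE; lia.
  - by rewrite Ei; apply: ideal_of_gen; left.
  by rewrite Ek; apply: ideal_of_gen; right.
apply: ideal_of_min => q [|] ->; apply: ideal_of_gen.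
  exists (row i (relmx c r)); last by rewrite Ei.
  by apply/vL; exists 1, 0, 0; rewrite scale1r !scale0r !addr0.
exists (row k (relmx c r)); last by rewrite Ek.
by apply/vL; exists 0, 1, 0; rewrite scale1r !scale0r addr0 add0r.
Qed.

Theorem proposition4p6
  (K : fieldType) (charK : [pchar K] =i pred0)
  (h : 'I_3 -> nat)
  (h_min : forall i : 'I_3, ~~ in_semigroup h (predC1 i) (h i))
  (h_gcd : (\big[gcdn/0]_(i < 3) h i)%N = 1%N)
  (c : 'I_3 -> nat) (r : 'I_3 -> 'I_3 -> nat)
  (c_min : forall i : 'I_3, smallest_multiple h i (c i))
  (r_rel : forall i : 'I_3, (c i * h i = \sum_(j < 3 | j != i) r i j * h j)%N)
  (v_gen : forall w : 'rV[int]_3,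
     w \in relation_lattice h <-> exists a : 'rV[int]_3, w = a *m relmx c r)
  (v_cases : structure_cases c r) :
  (\sum_(i < 3) row i (relmx c r) = 0 ->
     forall i : 'I_3,
       T1_degree_dim K h (- (h i)%:Z) 1 /\
       separable_at K (relation_lattice h) i)
  /\
  (\sum_(i < 3) row i (relmx c r) <> 0 ->
     (exists i k l : 'I_3, complete_intersection_form K h c r i k l) /\
     (forall i k l : 'I_3, complete_intersection_form K h c r i k l ->
        T1_degree_zero K h (- (h i)%:Z) /\
        forall j : 'I_3, j != i ->
          ~ T1_degree_zero K h (- (h j)%:Z) /\
          separable_at K (relation_lattice h) j)).
Proof.
have c0 j : (0 < c j)%N by have [] := c_min j.
have dim1 i k l : uniq [:: i; k; l] -> r k i != 0%N \/ r l i != 0%N ->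
    T1_degree_dim K h (- (h i)%:Z) 1.
  move=> ikl ri; apply: (T1_degree_dim1 charK h_min ikl) => v vL v0.
  exact: (vdegree_divisible h_min c_min r_rel ikl ri vL v0).
split=> [v0 i|v0].
  case: v_cases => [[r0 _]|[a [b [d [abd va vb vd]]]]|[/eqP]]; last by rewrite v0.
    have [k [l ikl]] := ord3_others i; have [[ki ik li il kl] lk] := uniq3_neq ikl.
    split; first by apply: (dim1 i k l) => //; left; rewrite r0 // ki.
    apply: (separable_determinantal K c0 v_gen ikl) => //.
    by move: v0; rewrite (big_ord3 _ _ ikl).
  (* The second case is invariant under cyclic rotation, so it suffices to treat the first index of
     the triple. *)
  have pure a' b' d' : uniq [:: a'; b'; d'] ->
      row a' (relmx c r) = (c a')%:Z *: delta_mx 0 a' - (c b')%:Z *: delta_mx 0 b' ->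
      row b' (relmx c r) = (c b')%:Z *: delta_mx 0 b' - (c d')%:Z *: delta_mx 0 d' ->
      row d' (relmx c r) = (c d')%:Z *: delta_mx 0 d' - (c a')%:Z *: delta_mx 0 a' ->
      T1_degree_dim K h (- (h a')%:Z) 1 /\ separable_at K (relation_lattice h) a'.
    move=> u3 va' vb' vd'; split; last exact: (separable_pure_powers K c0 v_gen u3).
    apply: (dim1 a' b' d') => //; right.
    have [[ba ab da ad bd] db] := uniq3_neq u3.
    have := congr1 (fun x : 'rV_3 => x 0 a') vd'.
    by rewrite !mxE !eqxx ad /=; have := c0 a'; lia.
  have [_ _ bda dab _] := uniq3_perm abd.
  have /or3P[/eqP ->|/eqP ->|/eqP ->] := ord3_cover i abd.
  - exact: (pure a b d).
  - exact: (pure b d a).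
  exact: (pure d a b).
have [k' [l' [kl' vkl' r']]] : exists k l : 'I_3,
    [/\ k != l, row k (relmx c r) + row l (relmx c r) = 0 &
        forall i j, i \notin [:: k; l] -> j \in [:: k; l] -> r i j != 0%N].
  (* The first two cases have vanishing sum, which leaves the third. *)
  case: v_cases => [[_ E]|[a [b [d [abd va vb vd]]]]|[_ H]] //.
  case: v0; rewrite (big_ord3 _ _ abd) /= va vb vd.
  by apply/rowP => j; rewrite !mxE; ring.
have vlk' : row l' (relmx c r) + row k' (relmx c r) = 0 by rewrite addrC.
(* The opposite pair must be {k, l}: if i belonged to it, the entry of row i at the index outside
   the pair would vanish. *)
have CI i k l : uniq [:: i; k; l] -> r i k != 0%N -> r i l != 0%N ->
    row k (relmx c r) + row l (relmx c r) = 0.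
  move=> ikl rik ril; have [[ki ik li il kl] lk] := uniq3_neq ikl.
  have /or3P[/eqP Ek|/eqP Ek|/eqP Ek] := ord3_cover k' ikl;
  have /or3P[/eqP El|/eqP El|/eqP El] := ord3_cover l' ikl;
    move: kl' vkl' vlk'; rewrite Ek El ?eqxx // => _ vkl vlk.
  - by move: ril; rewrite (opposite_rows vkl _ _).1 // ?li ?lk.
  - by move: rik; rewrite (opposite_rows vkl _ _).1 // ?ki ?kl.
  - by move: ril; rewrite (opposite_rows vlk _ _).1 // ?li ?lk.
  by move: rik; rewrite (opposite_rows vlk _ _).1 // ?ki ?kl.
split.
  have [i ikl] := ord3_third kl'; have [[ki ik li il _] _] := uniq3_neq ikl.
  have i_out : i \notin [:: k'; l'] by rewrite !inE ik il.
  exists i, k', l'; apply: complete_intersection_formI => //; apply: r' => //.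
    by rewrite inE eqxx.
  by rewrite !inE eqxx orbT.
move=> i k l [ikl _ rik ril].
have vkl := CI _ _ _ ikl rik ril.
have [ilk kil kli lik lki] := uniq3_perm ikl.
have [[ki ik li il kl] lk] := uniq3_neq ikl.
(* Row k witnesses the vanishing in degree -h_i: its i-th entry is 0, its degree is c_k h_k, and c_k
   h_k - h_i is not in H. *)
have kL : row k (relmx c r) \in relation_lattice h.
  by apply/(lattice_gen v_gen ikl); exists 0, 1, 0; rewrite scale1r !scale0r addr0 add0r.
have [rki _] : r k i = 0%N /\ r l i = 0%N.
  by apply: (opposite_rows vkl); rewrite ?ik ?il.
have rkl : r k l = c l by apply: (opposite_rows_diag vkl); rewrite kl.
have ki0 : row k (relmx c r) 0 i = 0 by rewrite relmxE ik rki.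
have [Ek El] := vdegree_kl h_min ikl kL ki0.
rewrite relmxE eqxx /= in Ek; rewrite relmxE lk rkl abszN /= in El.
have Ekl : (c k * h k = c l * h l)%N by rewrite -Ek El.
split.
  apply: (T1_degree_zero_of charK h_min ikl kL ki0) => [|m Hm].
    apply/eqP => k0; have := congr1 (fun y : 'rV_3 => y 0 k) k0.
    by rewrite relmxE mxE eqxx => -[ck]; have := c0 k; rewrite ck.
  rewrite Ek; exact: (vdegree_not_divisible h_min c_min r_rel ikl).
(* For j = k or j = l, the entry r_ij <> 0 of row i puts h(v) - h_j in H for every nonzero v in
   L. *)
have nonzero j a : uniq [:: j; i; a] -> r i j != 0%N -> ~ T1_degree_zero K h (- (h j)%:Z).
  move=> jia rij; apply: (T1_degree_nonzero charK h_min jia) => v vL vn0.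
  by apply: (vdegree_divisible h_min c_min r_rel jia _ vL vn0); left.
move=> j ji; have /or3P[/eqP Ej|/eqP ->|/eqP ->] := ord3_cover j ikl.
- by rewrite Ej eqxx in ji.
- split; first exact: (nonzero k l).
  exact: (separable_complete_intersection K c0 v_gen ikl).
split; first exact: (nonzero l k).
by apply: (separable_complete_intersection K c0 v_gen ilk) => //; rewrite addrC.
Qed.
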